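(* Let $l\ge 3$ and let $a_1<a_2<\dots<a_{2l}$ be real numbers. The minitwistor space $(S,\tau)$ associated to the ALE hyperkähler metric on the minimal resolution of the A$_{2l-1}$-singularity determined by $a_1,\dots,a_{2l}$ is isomorphic to the minimal resolution of $\mathscr T$ equipped with the real structure induced from the real structure $\sigma$ on $\mathscr T$, where $\mathscr T$ is a minitwistor space associated to a (real) hyperelliptic curve of genus $l-1$.
   Context: **The surface $(S,\tau)$.** Let $Z$ be the hypersurface $xy=(z-a_1u)(z-a_2u)\cdots(z-a_{2l}u)$ in the total space of $\mathcal O(2l)\oplus\mathcal O(2l)\oplus\mathcal O(2)$ over $\mathbb{CP}_1$, where $u$ is an affine coordinate on $\mathbb{CP}_1$, $x,y\in\mathcal O(2l)$ and $z\in\mathcal O(2)$. A resolution of $Z$ is the twistor space of an ALE hyperkähler metric on the minimal resolution of $\mathbb C^2/\Gamma$, $\Gamma\simeq\mathbb Z_{2l}\subset{\rm SU}(2)$. $Z$ has the real structure $(x,y,z,u)\mapsto(\bar y/\bar u^{2l},\bar x/\bar u^{2l},-\bar z/\bar u^2,-1/\bar u)$ and the $\mathbb C^*$-action $(x,y,z,u)\mapsto(s^lx,s^ly,sz,su)$. The fiber of $Z\to\mathbb{CP}_1$ over $u=1$ is the affine surface $xy=(z-a_1)\cdots(z-a_{2l})$ in $\mathbb C^3$. $S$ is its compactification obtained by regarding $z$ as an affine coordinate on $\mathbb{CP}_1$ and $(x,y)$ as affine fiber coordinates on the $\mathbb{CP}_2$-bundle $\mathbb P(\mathcal O(l)\oplus\mathcal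 O(l)\oplus\mathcal O)$ over $\mathbb{CP}_1$; $S$ is a smooth projective surface and a conic bundle over $\mathbb{CP}_1$. The real structure $\tau$ on $S$ is the composition of the real structure of $Z$ (mapping the fiber over $u=1$ to that over $u=-1$) with the action of $s=-1$, i.e. $\tau(x,y,z)=((-1)^l\bar y,(-1)^l\bar x,\bar z)$. **The surface $(\mathscr T,\sigma)$.** For $g>1$ and real numbers $\lambda_1<\lambda_1'<\dots<\lambda_{g+1}<\lambda'_{g+1}$, put $f(z)=-\prod_{i=1}^{g+1}(z-\lambda_i)(z-\lambda_i')$. The minitwistor space associated to the real hyperelliptic curve $\Sigma:w^2=f(z)$ of genus $g$ is the surface $\mathscr T\subset\mathbb{CP}_{g+3}$ that is the double cover, branched along $\Sigma$, of the cone ${\rm C}(\Lambda)\subset\mathbb{CP}_{g+2}$ over the rational normal curve $\Lambda=\{[1:z:\dots:z^{g+1}]\}\subset\mathbb{CP}_{g+1}$, where $\Sigma\subset{\rm C}(\Lambda)$ via $(z,w)\mapsto[1:z:\dots:z^{g+1}:w]$. Explicitly, $\mathscr T$ consists of points $[X_0:\dots:X_{g+1}:W:Y]$ with $(X_0,\dots,X_{g+1})$ in the affine cone over $\Lambda$ and $Y^2=q(X)-W^2$, where $q$ is a quadratic form with $q(1,z,\dots,z^{g+1})=f(z)$; in affine coordinates $y^2=f(z)-w^2$. Its real structure is $\sigma(z,w,y)=(\bar z,\bar w,\bar y)$. It has exactly two singular points (over the vertex of the cone). An isomorphism here is a biholomorphic map commuting with the real structures. *)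

(* Defs.v *)
From HB Require Import structures.
From Stdlib Require Import RelationClasses.
From mathcomp Require Import all_boot all_order all_algebra generic_quotient.
From mathcomp Require Import all_classical all_reals all_analysis.
From mathcomp.real_closed Require Import complex.

Set Implicit Arguments.
Unset Strict Implicit.
Unset Printing Implicit Defensive.
Import Order.TTheory GRing.Theory Num.Theory.
Import numFieldNormedType.Exports.
Local Open Scope classical_set_scope.
Local Open Scope ring_scope.

(** Throughout, a complex space is presented as a "space with functions": a
    topological space together with the predicate telling which complex-valued
    functions are holomorphic at (i.e. near) a given point.  This is how a reduced
    complex analytic space is determined by its sheaf of functions. *)

Definition Cplx (R : realType) : numClosedFieldType := R[i].

Definition ofReal (R : realType) (x : R) : Cplx R := x%:C%C.

Record holspace (R : realType) := Holspace {
  carrier :> topologicalType;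
  hol_at : carrier -> (carrier -> Cplx R) -> Prop }.

Section Holomorphy.
Context {R : realType}.
Local Notation C := (Cplx R).

(** Only the germ at [x] matters: [U] and the values of [f] far from [x] do not. *)
Definition ambient_hol_at (V : normedModType C) (x : V) (f : V -> C) : Prop :=
  \forall y \near x, differentiable (f : V -> C^o) y.

Definition affine_space (n : nat) : holspace R :=
  @Holspace R 'rV[C]_n (fun x f => ambient_hol_at x f).

Definition holomorphic_at (X Y : holspace R) (f : X -> Y) (x : X) : Prop :=
  {for x, continuous f} /\ forall h : Y -> C, hol_at (f x) h -> hol_at x (h \o f).

Definition antiholomorphic_at (X Y : holspace R) (f : X -> Y) (x : X) : Prop :=
  {for x, continuous f} /\
  forall h : Y -> C, hol_at (f x) h -> hol_at x (fun y => (h (f y))^*).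

Definition holomorphic (X Y : holspace R) (f : X -> Y) : Prop :=
  forall x, holomorphic_at f x.

(** [A] and [B] are meant to be open; the values of [f] outside [A] are irrelevant. *)
Definition biholomorphic_on (X Y : holspace R) (A : set X) (B : set Y)
    (f : X -> Y) : Prop :=
  exists g : Y -> X,
    [/\ forall x, A x -> B (f x) /\ g (f x) = x,
        forall y, B y -> A (g y) /\ f (g y) = y,
        forall x, A x -> holomorphic_at f x
      & forall y, B y -> holomorphic_at g y].

Definition biholomorphic (X Y : holspace R) (f : X -> Y) : Prop :=
  biholomorphic_on [set: X] [set: Y] f.

Definition real_structure (X : holspace R) (s : X -> X) : Prop :=
  involutive s /\ forall x, antiholomorphic_at s x.

(** The points at which a two-dimensional space is smooth. *)
Definition regular_locus (X : holspace R) : set X :=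
  [set x : X | exists (U : set X) (V : set (affine_space 2)) (phi : X -> affine_space 2),
    [/\ open U, U x, open V & biholomorphic_on U V phi]].

Arguments regular_locus : clear implicits.

(** No countability axiom is imposed: it is automatic for the resolutions of a
    projective surface, which are compact. *)
Definition complex_surface (X : holspace R) : Prop :=
  hausdorff_space X /\ forall x, regular_locus X x.

Definition resolution (X T : holspace R) (p : X -> T) : Prop :=
  [/\ complex_surface X,
      holomorphic p,
      forall K : set T, compact K -> compact (p @^-1` K),
      dense (p @^-1` regular_locus T)
    & biholomorphic_on (p @^-1` regular_locus T) (regular_locus T) p].

(** [E] is an exceptional curve of the first kind of the resolution [p]: a set, not
    reduced to one point, which can be blown down to a smooth point [x'] of
    another resolution [p'] through which [p] factors.  For normal [T], by theorems of
    Castelnuovo and Grauert, [p] has such a curve iff one of its fibers contains a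
    smooth rational curve of self-intersection -1. *)
Definition exceptional_first_kind (X T : holspace R) (p : X -> T) (E : set X) : Prop :=
  exists (X' : holspace R) (p' : X' -> T) (b : X -> X') (x' : X'),
    [/\ resolution p', holomorphic b, p =1 p' \o b, E = b @^-1` [set x']
      & biholomorphic_on (~` E) (~` [set x']) b /\
        exists e1 e2, [/\ E e1, E e2 & e1 <> e2]].

Definition minimal_resolution (X T : holspace R) (p : X -> T) : Prop :=
  resolution p /\ forall E : set X, ~ exceptional_first_kind p E.

End Holomorphy.

(** Subspaces of a quotient variety given by their cone in homogeneous coordinates:
    [K] is a set of coordinate vectors and [e] identifies the vectors representing the
    same point.  A function is holomorphic at a point when, in homogeneous
    coordinates, it is locally the restriction to [K] of a holomorphic function
    of the ambient vector space. *)
Section Orbits.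
Local Open Scope quotient_scope.
Context {R : realType} {V : normedModType (Cplx R)}.
Variables (K : set V) (e : V -> V -> Prop).
Hypothesis eE : Equivalence e.

Definition orbit_relb (v w : K) : bool := `[< e (\val v) (\val w) >].

Lemma orbit_relb_refl : reflexive orbit_relb.
Proof. by move=> v; apply/asboolP; reflexivity. Qed.

Lemma orbit_relb_sym : symmetric orbit_relb.
Proof. by move=> v w; apply/asboolP/asboolP => ?; symmetry. Qed.

Lemma orbit_relb_trans : transitive orbit_relb.
Proof.
by move=> v u w /asboolP uv /asboolP vw; apply/asboolP; transitivity (\val v).
Qed.

Definition orbit_rel : equiv_rel K :=
  EquivRel orbit_relb orbit_relb_refl orbit_relb_sym orbit_relb_trans.

Definition orbit_type : topologicalType := quotient_topology {eq_quot orbit_rel}.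

Definition orbit_class (v : K) : orbit_type := \pi_({eq_quot orbit_rel}) v.

Definition orbit_repr (x : orbit_type) : K := repr (x : {eq_quot orbit_rel}).

Definition orbit_space : holspace R :=
  @Holspace R orbit_type (fun x f =>
    forall v : K, orbit_class v = x ->
      exists F : V -> Cplx R, ambient_hol_at (\val v) F /\
        \forall w \near \val v, forall hw : w \in K,
          f (orbit_class (exist _ w hw)) = F w).

Definition orbit_map (h : V -> V) (hK : forall v, K v -> K (h v))
    (x : orbit_space) : orbit_space :=
  orbit_class (exist _ (h (\val (orbit_repr x)))
                 (mem_set (hK _ (set_mem (valP (orbit_repr x)))))).

Lemma orbit_mapE (h : V -> V) (hK : forall v, K v -> K (h v))
    (he : forall v w, e v w -> e (h v) (h w)) (v w : K) :
  \val w = h (\val v) -> orbit_map hK (orbit_class v) = orbit_class w.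
Proof.
move=> vw; apply/eqmodP/asboolP => /=; rewrite vw; apply: he.
by have /eqmodP/asboolP := reprK (orbit_class v).
Qed.

End Orbits.

Section ConicBundle.
Context {R : realType}.
Local Notation C := (Cplx R).
Variables (l : nat) (a : 'I_l.*2 -> R).

(** Homogeneous coordinates [(z0, z1, x, y, t)] on the total space of
    P(O(l) + O(l) + O) over CP_1; the affine coordinates of the surface
    xy = (z - a_1)...(z - a_2l) are recovered for z0 = t = 1, z = z1. *)
Definition bundle_vect : normedModType C := (C^o * C^o * C^o * C^o * C^o)%type.

Definition bundle_rel (v w : bundle_vect) : Prop :=
  exists c d : C, [/\ c != 0, d != 0 &
    let: (z0, z1, x, y, t) := v in
    w = (c * z0, c * z1, c ^+ l * d * x, c ^+ l * d * y, d * t)].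

Lemma bundle_relE : Equivalence bundle_rel.
Proof.
split.
- move=> [[[[z0 z1] x] y] t]; exists 1, 1.
  by rewrite oner_eq0 expr1n !mul1r; split.
- move=> [[[[z0 z1] x] y] t] w [c [d [c0 d0 ->]]].
  exists c^-1, d^-1; rewrite !invr_eq0; split => //.
  have cld (s : C) : c ^- l * d^-1 * (c ^+ l * d * s) = s.
    by rewrite -invfM mulKf // mulf_neq0 ?expf_neq0.
  by rewrite !exprVn !cld !mulKf.
- move=> [[[[z0 z1] x] y] t] _ w' [c [d [c0 d0 ->]]] [c' [d' [c'0 d'0 ->]]].
  exists (c' * c), (d' * d); split; rewrite ?mulf_neq0 //.
  have cld (s : C) :
    c' ^+ l * d' * (c ^+ l * d * s) = (c' * c) ^+ l * (d' * d) * s.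
    by rewrite exprMn !mulrA; congr (_ * _ * _); rewrite mulrAC.
  by rewrite !cld !mulrA.
Qed.

Definition bundle_cone : set bundle_vect :=
  [set v | let: (z0, z1, x, y, t) := v in
    [/\ ~ (z0 = 0 /\ z1 = 0), ~ [/\ x = 0, y = 0 & t = 0] &
        x * y = t ^+ 2 * \prod_(i < l.*2) (z1 - ofReal (a i) * z0)]].

Definition ALE_surface : holspace R := orbit_space bundle_cone bundle_relE.

Definition tau_vect (v : bundle_vect) : bundle_vect :=
  let: (z0, z1, x, y, t) := v in
  (z0^*, z1^*, (-1) ^+ l * y^*, (-1) ^+ l * x^*, t^*).

Lemma conj_ofReal (r : R) : (ofReal r)^* = ofReal r.
Proof. exact: conjc_real. Qed.

Lemma tau_cone (v : bundle_vect) : bundle_cone v -> bundle_cone (tau_vect v).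
Proof.
have conj0 (s : C) : s^* = 0 -> s = 0 by move/eqP; rewrite conjC_eq0 => /eqP.
have sgn0 (s : C) : (-1) ^+ l * s^* = 0 -> s = 0.
  by move/eqP; rewrite mulf_eq0 signr_eq0 /= conjC_eq0 => /eqP.
case: v => [[[[z0 z1] x] y] t] [z_neq0 xyt_neq0 xy]; split.
- by move=> [/conj0 ? /conj0 ?]; apply: z_neq0.
- by move=> [/sgn0 ? /sgn0 ? /conj0 ?]; apply: xyt_neq0.
- rewrite mulrACA -expr2 sqrr_sign mul1r mulrC -rmorphM /= xy.
  rewrite rmorphM rmorphXn rmorph_prod /=; congr (_ * _).
  by apply: eq_bigr => i _; rewrite rmorphB rmorphM /= conj_ofReal.
Qed.

Definition tau : ALE_surface -> ALE_surface := @orbit_map _ _ _ _ bundle_relE _ tau_cone.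

Lemma tauE (v w : bundle_cone) : \val w = tau_vect (\val v) ->
  tau (orbit_class bundle_relE v) = orbit_class bundle_relE w.
Proof.
apply: orbit_mapE => -[[[[z0 z1] x] y] t] _ [c [d [c0 d0 ->]]].
exists c^*, d^*; rewrite !conjC_eq0; split => //=.
have cld (s : C) : (-1) ^+ l * (c ^+ l * d * s)^* =
    c^* ^+ l * d^* * ((-1) ^+ l * s^*).
  by rewrite !rmorphM rmorphXn /= mulrCA.
by rewrite !cld !rmorphM.
Qed.

End ConicBundle.

Arguments ALE_surface {R l} a.
Arguments tau {R l} a.

Section Hyperelliptic.
Context {R : realType}.
Local Notation C := (Cplx R).
Variables (g : nat).

Definition hyperelliptic_poly (lam lam' : 'I_g.+1 -> R) : {poly R} :=
  - \prod_(i < g.+1) (('X - (lam i)%:P) * ('X - (lam' i)%:P)).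

Variable Q : 'M[R]_g.+2.

Definition quad_form (X : 'rV[C]_g.+2) : C :=
  \sum_(i < g.+2) \sum_(j < g.+2) ofReal (Q i j) * X 0 i * X 0 j.

Definition normal_cone (X : 'rV[C]_g.+2) : Prop :=
  exists c s t : C, forall i : 'I_g.+2, X 0 i = c * s ^+ (g.+1 - i) * t ^+ i.

Definition minitwistor_vect : normedModType C :=
  ('rV[C]_g.+2 * C^o * C^o)%type.

Definition homothety (v w : minitwistor_vect) : Prop :=
  exists2 c : C, c != 0 & w = c *: v.

Lemma homothetyE : Equivalence homothety.
Proof.
split.
- by move=> v; exists 1; rewrite ?oner_eq0 ?scale1r.
- move=> v _ [c c0 ->]; exists c^-1; rewrite ?invr_eq0 //.
  by rewrite scalerA mulVf ?scale1r.
- move=> v _ _ [c c0 ->] [d d0 ->]; exists (d * c); rewrite ?mulf_neq0 //.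
  by rewrite scalerA.
Qed.

Definition minitwistor_cone : set minitwistor_vect :=
  [set v | let: (X, W, Y) := v in
    [/\ v <> 0, normal_cone X & Y ^+ 2 = quad_form X - W ^+ 2]].

Definition minitwistor : holspace R := orbit_space minitwistor_cone homothetyE.

Definition sigma_vect (v : minitwistor_vect) : minitwistor_vect :=
  let: (X, W, Y) := v in (map_mx Num.conj X, W^*, Y^*).

Lemma sigma_cone (v : minitwistor_vect) :
  minitwistor_cone v -> minitwistor_cone (sigma_vect v).
Proof.
case: v => [[X W] Y] [v0 [c [s [t Xe]]] YW]; split.
- move=> [] /matrixP X0 /eqP W0 /eqP Y0; apply: v0.
  move: W0 Y0; rewrite !conjC_eq0 => /eqP -> /eqP ->.
  congr (_, _, _); apply/matrixP => i j; move: (X0 i j); rewrite !mxE.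
  by move/eqP; rewrite conjC_eq0 => /eqP.
- exists c^*, s^*, t^* => i; rewrite mxE Xe.
  by rewrite !rmorphM !rmorphXn.
- rewrite -!rmorphXn /= YW rmorphB /=; congr (_ - _).
  rewrite /quad_form rmorph_sum /=; apply: eq_bigr => i _.
  rewrite rmorph_sum /=; apply: eq_bigr => j _.
  by rewrite !mxE !rmorphM /= conj_ofReal.
Qed.

Definition sigma : minitwistor -> minitwistor := @orbit_map _ _ _ _ homothetyE _ sigma_cone.

Lemma sigmaE (v w : minitwistor_cone) : \val w = sigma_vect (\val v) ->
  sigma (orbit_class homothetyE v) = orbit_class homothetyE w.
Proof.
apply: orbit_mapE => -[[X W] Y] _ [c c0 ->].
exists c^*; rewrite ?conjC_eq0 //; congr (_, _, _).
- by apply/matrixP => i j; rewrite !mxE rmorphM.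
- exact: rmorphM.
- exact: rmorphM.
Qed.

(** [minitwistor] is the surface attached to the curve w^2 = f(z), where f is
    [hyperelliptic_poly lam lam']; it depends on [Q] only
    through f, so that taking [Q] real is no restriction. *)
Definition hyperelliptic_data (lam lam' : 'I_g.+1 -> R) : Prop :=
  [/\ (1 < g)%N,
      forall i, lam i < lam' i,
      forall i j : 'I_g.+1, (i < j)%N -> lam' i < lam j
    & forall z : C, quad_form (\row_i z ^+ i) =
        (map_poly (@ofReal R) (hyperelliptic_poly lam lam')).[z]].

End Hyperelliptic.

Arguments minitwistor {R g} Q.
Arguments sigma {R g} Q.

(* Main.v *)
From HB Require Import structures.
From Stdlib Require Import RelationClasses.
Require Import Defs.
From mathcomp Require Import all_boot all_order all_algebra generic_quotient.
From mathcomp Require Import all_classical all_reals all_analysis.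
From mathcomp.real_closed Require Import complex.
From mathcomp Require Import ring.
Set Implicit Arguments.
Unset Strict Implicit.
Unset Printing Implicit Defensive.
Import Order.TTheory GRing.Theory Num.Theory.
Import numFieldNormedType.Exports.
Local Open Scope classical_set_scope.
Local Open Scope ring_scope.

(** Put l = n + 1. In homogeneous coordinates the surface S is x y = t^2 P(z0, z1) with P of
    degree 2 l. It has two disjoint curves at infinity, y = t = 0 and x = t = 0, both
    sections of the conic bundle with self-intersection -l. The expressions t u0^(l-i) u1^i,
    with u0, u1 linear coordinates on the base, have the same weight as x and y, so together
    they define a map [resol] from S to a projective space. When x and y are written as
    multiples of W + iY and W - iY, the equation of S becomes W^2 + Y^2 = q(X) on the cone
    over the rational normal curve of degree l: the image of [resol] is a minitwistor space.
    The map contracts each curve at infinity to a singular point and is an isomorphism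
    elsewhere ([resol_biholomorphic]). So S itself is the resolution sought.

    Reality fixes u0 and u1. The real structure of S sends x to (-1)^l times the conjugate
    of y, so W and Y are real only if q has a prescribed sign, while the polynomial of the
    curve must be minus a product of real linear factors. The change of coordinate z -> 1 /
    (m - z) multiplies P by the product of the m - a_i, whose sign can be chosen by placing
    m below all the a_i or between the first two of them ([exists_moving_point]).

    Minimality, and the fact that the vertices really are singular, follow from
    [no_smooth_contraction]: if [resol] factors as p' o b through a space Y, then b does not
    send two points of S to the same smooth point y of Y. Near a vertex [resol] is (z, t)
    |-> t nu(z) with nu(z) = (u0^l, u0^(l-1) u1, ..., u1^l). In a chart of Y at y the vertex
    coordinates become functions h on an open set of C^2, and a curve transversal to the
    section at z becomes a curve with some velocity T_z, so that dh(T_z) = nu(z). Two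
    different points over y give two independent vectors nu(z), hence dh is injective, hence
    h separates y from the points near it; but h vanishes on the image of the section, so a
    whole arc of the section is sent to y. Three points of the arc now give three
    independent vectors nu(z) in the image of the plane by dh, which is absurd. With Y the
    minitwistor space this shows that its regular locus is exactly the complement of the two
    vertices ([off_vertex_regular]); with Y another resolution it excludes exceptional
    curves of the first kind.

    Both surfaces are orbit spaces of cones. Since the projections are open
    ([nbhs_orbit_pt]), continuity, holomorphy and the Hausdorff property can be checked on
    vectors, charts are slices ([orbit_chart]), and the compactness of S makes [resol]
    proper. *)

(** * Complex differentiability *)

Section Calculus.
Context {R : realType}.
Local Notation C := (Cplx R).
Implicit Types V W : normedModType C.

Lemma differentiable_fst V (W1 W2 : normedModType C) (f : V -> (W1 * W2)%type) x :
  differentiable f x -> differentiable (fun v => (f v).1) x.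
Proof.
move=> df; apply: (@differentiable_comp _ _ _ _ f fst) => //.
have lin : linear (fst : W1 * W2 -> W1) by [].
pose F := GRing.isLinear.Build C (W1 * W2)%type W1 *:%R fst lin.
pose L : {linear (W1 * W2)%type -> W1} := HB.pack (fst : (W1 * W2)%type -> W1) F.
apply: (@linear_differentiable _ _ _ L) => u.
exact: cvg_fst.
Qed.

Lemma differentiable_snd V (W1 W2 : normedModType C) (f : V -> (W1 * W2)%type) x :
  differentiable f x -> differentiable (fun v => (f v).2) x.
Proof.
move=> df; apply: (@differentiable_comp _ _ _ _ f snd) => //.
have lin : linear (snd : W1 * W2 -> W2) by [].
pose F := GRing.isLinear.Build C (W1 * W2)%type W2 *:%R snd lin.
pose L : {linear (W1 * W2)%type -> W2} := HB.pack (snd : (W1 * W2)%type -> W2) F.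
apply: (@linear_differentiable _ _ _ L) => u.
exact: cvg_snd.
Qed.

Lemma differentiable_idf V (x : V) : differentiable (fun v => v) x.
Proof. by have [] := is_diff_id x. Qed.

Lemma differentiable_cstf V W (w : W) (x : V) : differentiable (fun=> w) x.
Proof. exact: differentiable_cst. Qed.

Lemma differentiable_addf V W (f g : V -> W) x : differentiable f x ->
  differentiable g x -> differentiable (fun v => f v + g v) x.
Proof. exact: differentiableD. Qed.

Lemma differentiable_oppf V W (f : V -> W) x : differentiable f x ->
  differentiable (fun v => - f v) x.
Proof. exact: differentiableN. Qed.

Lemma differentiable_mulf V (f g : V -> C^o) x : differentiable f x ->
  differentiable g x -> differentiable (fun v => f v * g v : C^o) x.
Proof. exact: differentiableM. Qed.

Lemma differentiable_invf V (f : V -> C^o) x : f x != 0 -> differentiable f x ->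
  differentiable (fun v => (f v)^-1 : C^o) x.
Proof. by move=> fx df; apply: differentiableV. Qed.

Lemma differentiable_expf V (f : V -> C^o) n x : differentiable f x ->
  differentiable (fun v => f v ^+ n : C^o) x.
Proof.
move=> df; elim: n => [|n ih]; first exact: differentiable_cstf.
under eq_fun do rewrite exprS.
exact: differentiable_mulf.
Qed.

Lemma differentiable_scalef V W (f : V -> C^o) (w : W) x : differentiable f x ->
  differentiable (fun v => (f v : C) *: w) x.
Proof. exact: differentiableZl. Qed.

Lemma differentiable_sumf V W (I : Type) (r : seq I) (f : I -> V -> W) x :
  (forall i, differentiable (f i) x) ->
  differentiable (fun v => \sum_(i <- r) f i v) x.
Proof.
move=> df; elim: r => [|i r ih].
  under eq_fun do rewrite big_nil.
  exact: differentiable_cstf.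
under eq_fun do rewrite big_cons.
exact: differentiable_addf.
Qed.

Lemma differentiable_prodf V (I : Type) (r : seq I) (P : pred I) (f : I -> V -> C^o) x :
  (forall i, differentiable (f i) x) ->
  differentiable (fun v => \prod_(i <- r | P i) (f i v : C) : C^o) x.
Proof.
move=> df; elim: r => [|i r ih].
  under eq_fun do rewrite big_nil.
  exact: differentiable_cstf.
under eq_fun do rewrite big_cons.
case: (P i) => //.
exact: differentiable_mulf.
Qed.

Lemma differentiable_coordf V n (f : V -> 'rV[C]_n) i x : differentiable f x ->
  differentiable (fun v => f v 0 i : C^o) x.
Proof.
move=> df; apply: (@differentiable_comp _ _ _ _ f (fun M : 'rV[C]_n => M 0 i : C^o)) => //.
exact: differentiable_coord.
Qed.

Lemma differentiable_rowf V n (f : 'I_n -> V -> C^o) x :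
  (forall i, differentiable (f i) x) ->
  differentiable (fun v => \row_i (f i v : C)) x.
Proof.
move=> df.
have -> : (fun v => \row_i f i v) =
    (fun v => \sum_i (f i v : C) *: delta_mx 0 i).
  apply/funext => v; rewrite [LHS]row_sum_delta; apply: eq_bigr => i _.
  by rewrite mxE.
by apply: differentiable_sumf => i; apply: differentiable_scalef.
Qed.

End Calculus.

(** Differentiability by structural recursion on the expression; that denominators do not
    vanish is left to the user. *)
Ltac diff_step :=
  match goal with
  | H : _ |- _ => exact: H
  | |- differentiable fst _ => apply: (differentiable_fst (differentiable_idf _))
  | |- differentiable snd _ => apply: (differentiable_snd (differentiable_idf _))
  | |- differentiable (fun v => v) _ => exact: differentiable_idf
  | |- differentiable (fun _ => ?c) _ => exact: differentiable_cstf
  | |- differentiable (fun v => _ + _) _ => apply: differentiable_addf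
  | |- differentiable (fun v => - _) _ => apply: differentiable_oppf
  | |- differentiable (fun v => _ * _) _ => apply: differentiable_mulf
  | |- differentiable (fun v => _ ^+ _) _ => apply: differentiable_expf
  | |- differentiable (fun v => _ ^-1) _ => apply: differentiable_invf
  | |- differentiable (fun v => \prod_(_ <- _ | _) _) _ => apply: differentiable_prodf => ?
  | |- differentiable (fun v => \sum_(_ <- _) _) _ => apply: differentiable_sumf => ?
  | |- differentiable (fun v => \row_i _) _ => apply: differentiable_rowf => ?
  | |- differentiable (fun v => (_, _)) _ => apply: differentiable_pair
  | |- differentiable (fun v => fst _) _ => apply: differentiable_fst
  | |- differentiable (fun v => snd _) _ => apply: differentiable_snd
  | |- differentiable (fun v => fun_of_matrix _ _ _) _ => apply: differentiable_coordf
  end.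
Ltac diff := repeat diff_step.

Section Germs.
Context {R : realType}.
Local Notation C := (Cplx R).
Implicit Types V W : normedModType C.

Lemma nbhs_preimage_differentiable V W (f : V -> W) x (B : set W) :
  differentiable f x -> nbhs (f x) B -> nbhs x (f @^-1` B).
Proof. by move=> df; exact: (differentiable_continuous df). Qed.

Lemma nbhs_neq0_differentiable V W (f : V -> W) x :
  differentiable f x -> f x != 0 -> nbhs x [set y | f y != 0].
Proof. by move=> df; exact: (cvgr_neq0 _ (differentiable_continuous df)). Qed.

Lemma differentiable_eps V W (f : V -> W) x : differentiable f x ->
  forall eps : C, 0 < eps ->
  \forall h \near 0, `|f (h + x) - f x - 'd f x h| <= eps * `|h|.
Proof.
move=> /diff_locallyP[_ /eqaddoP E] eps eps0.
by apply: filterS (E _ eps0) => h; rewrite /= opprD addrA.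
Qed.

Lemma is_diff_eps V W (f : V -> W) (L : {linear V -> W}) x : continuous L ->
  (forall eps : C, 0 < eps ->
     \forall h \near 0, `|f (h + x) - f x - L h| <= eps * `|h|) ->
  is_diff x f L.
Proof.
move=> cL fL.
have E : f \o shift x = cst (f x) + L +o_0 id.
  apply/eqaddoP => eps eps0; apply: filterS (fL _ eps0) => h.
  by rewrite /= opprD addrA.
have dL := diff_unique cL E.
apply: DiffDef => //; apply/diff_locallyP.
by rewrite dL.
Qed.

Lemma near_is_diff V W (f g : V -> W) x : (\forall y \near x, f y = g y) ->
  differentiable f x -> is_diff x g ('d f x).
Proof.
move=> fg df; have /diff_locallyP[cdf _] := df.
apply: is_diff_eps => // eps eps0.
have gx := nbhs_singleton fg.
have fg' : \forall h \near (0 : V), f (h + x) = g (h + x).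
  have c : {for 0, continuous (fun h : V => h + x)}.
    apply: differentiable_continuous; diff.
  have /c : nbhs ((0 : V) + x) [set y | f y = g y] by rewrite add0r.
  by [].
apply: filterS2 (differentiable_eps df eps0) fg' => h + <-.
by rewrite -gx.
Qed.

Lemma near_differentiable V W (f g : V -> W) x : (\forall y \near x, f y = g y) ->
  differentiable f x -> differentiable g x.
Proof. by move=> fg df; have [] := near_is_diff fg df. Qed.

Lemma near_diff V W (f g : V -> W) x : (\forall y \near x, f y = g y) ->
  differentiable f x -> 'd g x = 'd f x :> (V -> W).
Proof. by move=> fg df; have [] := near_is_diff fg df. Qed.

Lemma is_diff_sumf V W (I : Type) (r : seq I) (f df : I -> V -> W) x :
  (forall i, is_diff x (f i) (df i)) ->
  is_diff x (fun v => \sum_(i <- r) f i v) (fun v => \sum_(i <- r) df i v).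
Proof.
move=> dff; elim: r => [|i r ih].
  under [X in is_diff _ X _]eq_fun do rewrite big_nil.
  under [X in is_diff _ _ X]eq_fun do rewrite big_nil.
  exact: is_diff_cst.
under [X in is_diff _ X _]eq_fun do rewrite big_cons.
under [X in is_diff _ _ X]eq_fun do rewrite big_cons.
exact: is_diffD.
Qed.

Lemma ambient_hol_near V (x : V) (f g : V -> C) : (\forall y \near x, f y = g y) ->
  ambient_hol_at x f -> ambient_hol_at x g.
Proof.
move=> /near_join fg; apply: filterS2 fg => y fgy.
exact: near_differentiable.
Qed.

Lemma norm_pair_le V W (p : V * W) (M : C) :
  (`|p| <= M) = (`|p.1| <= M) && (`|p.2| <= M).
Proof.
rewrite prod_normE comparable_ge_max //.
by apply: real_comparable; rewrite normr_real.
Qed.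

End Germs.

Section Antilinear.
Context {R : realType} {V : normedModType (Cplx R)}.
Local Notation C := (Cplx R).
Variable J : V -> V.
Hypotheses (JD : forall u v, J (u + v) = J u + J v)
           (JZ : forall c v, J (c *: v) = c^* *: J v)
           (J_le : forall v, `|J v| <= `|v|).

Lemma antilinear_continuous v : {for v, continuous J}.
Proof.
move=> B; rewrite nbhs_ballP; move=> [d /= d0 dB]; apply/nbhs_ballP; exists d => //= w.
rewrite -!ball_normE /= => vw; apply: dB; rewrite -ball_normE /=.
have JN u : J (- u) = - J u by rewrite -scaleN1r JZ rmorphN1 scaleN1r.
by rewrite -JN -JD; exact: le_lt_trans (J_le _) vw.
Qed.

(** Complex conjugation on both sides turns a complex derivative into a complex
    derivative: the conjugate of a linear map precomposed with an antilinear one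
    is linear. *)
Lemma differentiable_conj (f : V -> C^o) x :
  differentiable f (J x) -> differentiable (fun v => (f (J v))^* : C^o) x.
Proof.
move=> df; have /diff_locallyP[cdf _] := df.
pose L := fun v => ('d f (J x) (J v))^* : C^o.
have lL : linear (L : V -> C^o).
  move=> c u v; rewrite /L JD JZ linearD linearZ /= rmorphD /= rmorphM /=.
  by rewrite conjCK.
pose F := GRing.isLinear.Build C V C^o *:%R L lL.
pose LL : {linear V -> C^o} := HB.pack L F.
have cC (z : C^o) : {for z, continuous (fun z : C^o => (z : C)^* : C^o)}.
  move=> B; rewrite nbhs_ballP; move=> [d /= d0 dB]; apply/nbhs_ballP; exists d => //= w.
  rewrite -!ball_normE /= => vw; apply: dB; rewrite -ball_normE /=.
  by rewrite -rmorphB norm_conjC.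
suff /@ex_diff : is_diff x (fun v => (f (J v))^* : C^o) LL by [].
apply: is_diff_eps => [v|eps eps0].
  move=> B /cC /cdf /antilinear_continuous; exact.
have J0 : J 0 = 0 by rewrite -(scale0r 0) JZ rmorph0 !scale0r.
have E : nbhs (J 0) [set h | `|f (h + J x) - f (J x) - 'd f (J x) h| <= eps * `|h|].
  by rewrite J0; exact: differentiable_eps.
have {}E : nbhs (0 : V) (J @^-1` [set h | _]) := antilinear_continuous E.
apply: filterS E => h /=.
rewrite JD /L -!rmorphB /= norm_conjC => /le_trans; apply.
by rewrite ler_pM2l.
Qed.

Lemma ambient_hol_conj (f : V -> C) x :
  ambient_hol_at (J x) f -> ambient_hol_at x (fun v => (f (J v))^*).
Proof.
move=> df; have {}df : nbhs x (J @^-1` [set y | differentiable (f : V -> C^o) y]) :=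
  antilinear_continuous df.
by apply: filterS df => y dfy; exact: differentiable_conj.
Qed.

End Antilinear.

(** * Orbit spaces *)

(** Equivalent vectors are related by a holomorphic map moving every vector within its
    class: this is what makes the projection to the orbit space open. *)
Definition orbit_action (R : realType) (V : normedModType (Cplx R)) (K : set V)
    (e : V -> V -> Prop) : Prop :=
  (forall v w, K v -> e v w -> K w) /\
  (forall v w, e v w -> exists A : V -> V,
    [/\ A v = w, forall u, e u (A u) & forall u, differentiable A u]).

Section OrbitSpace.
Local Open Scope quotient_scope.
Context {R : realType} {V : normedModType (Cplx R)}.
Local Notation C := (Cplx R).
Variables (K : set V) (e : V -> V -> Prop) (eE : Equivalence e).
Variable k0 : K.

(** The class of a vector, extended by a dummy value off the cone so that it can be
    applied without a proof of membership. *)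
Definition orbit_pt (v : V) : orbit_space K eE := orbit_class eE (insubd k0 v).

Lemma orbit_pt_class (k : K) : orbit_class eE k = orbit_pt (\val k).
Proof. by rewrite /orbit_pt valKd. Qed.

Lemma orbit_pt_surj (x : orbit_space K eE) : exists2 v, K v & x = orbit_pt v.
Proof.
exists (\val (orbit_repr x)); first exact: (set_mem (valP (orbit_repr x))).
by rewrite -orbit_pt_class; apply/esym; exact: reprK.
Qed.

Lemma val_orbit_pt (v : V) : K v -> \val (insubd k0 v) = v.
Proof. by move=> Kv; rewrite insubdK //; exact: mem_set. Qed.

Lemma orbit_ptP (v w : V) : K v -> K w -> orbit_pt v = orbit_pt w <-> e v w.
Proof.
move=> Kv Kw; rewrite -{2}(val_orbit_pt Kv) -{2}(val_orbit_pt Kw); split.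
  by move=> /eqmodP/asboolP.
by move=> evw; apply/eqmodP/asboolP.
Qed.

Lemma orbit_repr_ptP (v : V) : K v -> e v (\val (orbit_repr (orbit_pt v))).
Proof.
move=> Kv; apply/orbit_ptP => //.
  exact: (set_mem (valP (orbit_repr (orbit_pt v)))).
by rewrite -orbit_pt_class; apply/esym; exact: reprK.
Qed.

Lemma orbit_pt_continuous (v : V) (O : set (orbit_space K eE)) : K v ->
  nbhs (orbit_pt v) O -> \forall w \near v, K w -> O (orbit_pt w).
Proof.
move=> Kv /(@pi_continuous _ {eq_quot orbit_rel K eE} (insubd k0 v)).
rewrite /= nbhsE => -[_ [[B oB <-] Bv] BO].
have {}Bv : B v by move: Bv; change (B (\val (insubd k0 v)) -> B v); rewrite val_orbit_pt.
near=> w => Kw; apply: BO; change (B (\val (insubd k0 w))); rewrite val_orbit_pt //.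
by near: w; apply: open_nbhs_nbhs.
Unshelve. all: by end_near. Qed.

Hypothesis actK : orbit_action K e.
Let satK := actK.1.
Let actE := actK.2.

(** The projection to the orbit space is open: an open set of vectors is moved by
    the maps of [actE] to a neighbourhood of any other representative. *)
Lemma nbhs_orbit_pt (v : V) (O : set (orbit_space K eE)) : K v ->
  nbhs (orbit_pt v) O <-> \forall w \near v, K w -> O (orbit_pt w).
Proof.
move=> Kv; split; first exact: orbit_pt_continuous.
move=> Ov.
pose P : set V := [set u : V | \forall w \near u, K w -> O (orbit_pt w)].
pose U : set (orbit_space K eE) := [set x | exists u, [/\ K u, P u & x = orbit_pt u]].
have UO : U `<=` O by move=> x [u [Ku /nbhs_singleton Pu ->]]; exact: Pu.
apply: (filterS UO); apply: open_nbhs_nbhs; split; last by exists v.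
suff : open ((fun k : K => orbit_class eE k) @^-1` U) by [].
rewrite openE => k [u [Ku Pu]]; rewrite orbit_pt_class /=.
have Kk := set_mem (valP k).
move=> /(orbit_ptP Kk Ku)/actE[A [Aku eA dA]].
have PA : \forall w \near \val k, P (A w).
  by apply: (nbhs_preimage_differentiable (dA _)); rewrite /= Aku; exact: nbhs_interior.
have {}PA : nbhs k [set k' : K | P (A (\val k'))] := @initial_continuous K V set_val k _ PA.
change (nbhs k ((fun k : K => orbit_class eE k) @^-1` U)).
apply: filterS PA => k' Pk'; exists (A (\val k')); split => //.
- by apply: satK (eA _); exact: (set_mem (valP k')).
- rewrite orbit_pt_class; apply/orbit_ptP => //.
    exact: (set_mem (valP k')).
  by apply: satK (eA _); exact: (set_mem (valP k')).
Qed.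

(** One representative suffices, since the maps of [actE] carry its germ to the others. *)
Lemma orbit_hol_atP (v : V) (f : orbit_space K eE -> C) : K v ->
  hol_at (orbit_pt v) f <-> exists F : V -> C, ambient_hol_at v F /\
    \forall w \near v, K w -> f (orbit_pt w) = F w.
Proof.
move=> Kv; split => [fv|[F [dF fF]] k].
  have [|F [dF fF]] := fv (insubd k0 v); first by [].
  rewrite val_orbit_pt // in dF fF; exists F; split => //.
  apply: filterS fF => w fw Kw; rewrite -(fw (mem_set Kw)) /orbit_pt.
  by congr (f (orbit_class _ _)); apply: val_inj; rewrite /= val_orbit_pt.
rewrite orbit_pt_class => /(orbit_ptP (set_mem (valP k)) Kv)/actE[A [Akv eA dA]].
have cA (P : set V) : nbhs v P -> nbhs (\val k) (A @^-1` P).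
  by rewrite -Akv; exact: (nbhs_preimage_differentiable (dA (\val k))).
exists (F \o A); split.
  move: dF => /cA; apply: filterS => y dFy; exact: differentiable_comp.
move: fF => /cA; apply: filterS => w fA hw; rewrite /= -fA; last first.
  by apply: satK (eA _); exact: set_mem.
rewrite orbit_pt_class; congr f; apply/orbit_ptP => //; first exact: set_mem.
by apply: satK (eA _); exact: set_mem.
Qed.

(** Since the projection is open, two orbits are separated as soon as a continuous
    function of two vectors vanishing on [e] does not vanish on them. *)
Lemma orbit_hausdorff :
  (forall v w, K v -> K w -> ~ e v w -> exists Phi : V * V -> C^o,
    [/\ {for (v, w), continuous Phi}, Phi (v, w) != 0 &
        forall v' w', e v' w' -> Phi (v', w') = 0]) ->
  hausdorff_space (orbit_space K eE).
Proof.
move=> sep x y; have [v Kv ->] := orbit_pt_surj x; have [w Kw ->] := orbit_pt_surj y.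
move=> cl; apply: contrapT => xy.
have [|Phi [cPhi Phi0 Phie]] := sep v w Kv Kw; first by move/(orbit_ptP Kv Kw).
have := cvgr_neq0 _ cPhi Phi0.
move=> [[A B] [/= Av Bw] AB].
have Av' : nbhs (orbit_pt v) [set x | exists v', [/\ K v', A v' & x = orbit_pt v']].
  by apply/nbhs_orbit_pt => //; apply: filterS Av => v' Av' Kv'; exists v'.
have Bw' : nbhs (orbit_pt w) [set x | exists v', [/\ K v', B v' & x = orbit_pt v']].
  by apply/nbhs_orbit_pt => //; apply: filterS Bw => v' Bv' Kv'; exists v'.
have [_ [[v' [Kv' {}Av' ->]] [w' [Kw' {}Bw' vw']]]] := cl _ _ Av' Bw'.
have /eqP := AB (v', w') (conj Av' Bw'); apply.
exact/Phie/(orbit_ptP Kv' Kw').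
Qed.

(** A chart of the orbit space is a slice of the action over an open set of
    parameters, together with invariant functions recovering the parameters. *)
Lemma orbit_chart (Om : set V) (W : set 'rV[C]_2) (phi : V -> 'rV[C]_2)
    (s : 'rV[C]_2 -> V) :
  open Om -> open W ->
  (forall w, Om w -> differentiable phi w) ->
  (forall u, differentiable s u) ->
  (forall w w', K w -> Om w -> e w w' -> Om w' /\ phi w' = phi w) ->
  (forall u, W u -> [/\ K (s u), Om (s u) & phi (s u) = u]) ->
  (forall w, K w -> Om w -> W (phi w) /\ e w (s (phi w))) ->
  forall v, K v -> Om v -> @regular_locus R (orbit_space K eE) (orbit_pt v).
Proof.
move=> oOm oW dphi ds phie sP phiP v Kv Omv.
pose U : set (orbit_space K eE) := [set x | exists w, [/\ K w, Om w & x = orbit_pt w]].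
pose f : orbit_space K eE -> affine_space 2 := fun x => phi (\val (orbit_repr x)).
have fE w : K w -> Om w -> f (orbit_pt w) = phi w.
  by move=> Kw Omw; have [] := phie _ _ Kw Omw (orbit_repr_ptP Kw).
exists U, W, f; split; [|by exists v|exact: oW|].
  rewrite openE => x [w [Kw Omw ->]]; apply/nbhs_orbit_pt => //.
  have := open_nbhs_nbhs (conj oOm Omw).
  by apply: filterS => w' Omw' Kw'; exists w'.
exists (fun u => orbit_pt (s u)); split.
- move=> x [w [Kw Omw ->]]; rewrite fE //; have [Wphi ew] := phiP _ Kw Omw.
  by split => //; apply/esym/orbit_ptP => //; exact: satK ew.
- move=> u Wu; have [Ks Oms phis] := sP _ Wu.
  by rewrite fE //; split => //; exists (s u).
- move=> x [w [Kw Omw ->]].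
  have Omw' := open_nbhs_nbhs (conj oOm Omw).
  split.
    move=> /= B; rewrite fE // => /(nbhs_preimage_differentiable (dphi _ Omw)) Bw.
    apply/nbhs_orbit_pt => //.
    by apply: filterS2 Omw' Bw => w' Omw' Bw' Kw' /=; rewrite fE.
  move=> h; rewrite fE // => dh; apply/orbit_hol_atP => //; exists (h \o phi); split.
    have {}dh := nbhs_preimage_differentiable (dphi _ Omw) dh.
    apply: filterS2 Omw' dh => w' Omw' dh; apply: differentiable_comp => //.
    exact: dphi.
  by apply: filterS Omw' => w' Omw' Kw' /=; rewrite fE.
- move=> u Wu; have Wu' := open_nbhs_nbhs (conj oW Wu).
  have [Ks _ _] := sP _ Wu.
  split.
    move=> B /(orbit_pt_continuous Ks)/(nbhs_preimage_differentiable (ds u)).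
    by apply: filterS2 Wu' => u' Wu' B'; apply: B'; have [] := sP _ Wu'.
  move=> h /(orbit_hol_atP _ Ks)[F [dF hF]].
  have {}hF := nbhs_preimage_differentiable (ds u) hF.
  have {}dF := nbhs_preimage_differentiable (ds u) dF.
  apply: (@ambient_hol_near _ _ _ (F \o s)).
    by apply: filterS2 hF Wu' => y hF Wy; rewrite /= -hF //; have [] := sP _ Wy.
  apply: filterS dF => y dFy; apply: differentiable_comp => //; exact: ds.
Qed.

End OrbitSpace.

Section OrbitMaps.
Context {R : realType} {V1 V2 : normedModType (Cplx R)}.
Local Notation C := (Cplx R).
Variables (K1 : set V1) (e1 : V1 -> V1 -> Prop) (eE1 : Equivalence e1) (k1 : K1).
Variables (K2 : set V2) (e2 : V2 -> V2 -> Prop) (eE2 : Equivalence e2) (k2 : K2).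
Hypotheses (act1 : orbit_action K1 e1) (act2 : orbit_action K2 e2).
Local Notation pt1 := (orbit_pt eE1 k1).
Local Notation pt2 := (orbit_pt eE2 k2).
Variables (f : orbit_space K1 eE1 -> orbit_space K2 eE2) (G : V1 -> V2) (v : V1).
Hypothesis Kv : K1 v.
Hypothesis fG : \forall w \near v, K1 w -> K2 (G w) /\ f (pt1 w) = pt2 (G w).

Lemma orbit_map_continuous_at : {for v, continuous G} -> {for pt1 v, continuous f}.
Proof.
have [KG fv] := nbhs_singleton fG Kv.
move=> cG B /=; rewrite fv => /(orbit_pt_continuous KG) BG.
have {}BG : nbhs v (G @^-1` [set w | K2 w -> B (pt2 w)]) := cG _ BG.
apply/(nbhs_orbit_pt k1 act1) => //.
by apply: filterS2 fG BG => w fGw BG /fGw [KGw /= ->]; exact: BG.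
Qed.

Lemma orbit_map_holomorphic_at :
  (\forall w \near v, differentiable G w) -> holomorphic_at f (pt1 v).
Proof.
have [KG fv] := nbhs_singleton fG Kv.
move=> dG; have dGv := nbhs_singleton dG; split.
  exact/orbit_map_continuous_at/differentiable_continuous.
move=> h; rewrite fv => /(orbit_hol_atP _ act2 _ KG)[F [dF hF]].
apply/(orbit_hol_atP _ act1) => //; exists (F \o G); split.
  have {}dF := nbhs_preimage_differentiable dGv dF.
  by apply: filterS2 dG dF => w dGw dFw; exact: differentiable_comp.
have {}hF := nbhs_preimage_differentiable dGv hF.
by apply: filterS2 fG hF => w fGw hF /fGw [KGw /= ->]; exact: hF.
Qed.

Lemma orbit_map_antiholomorphic_at : {for v, continuous G} ->
  (forall F : V2 -> C, ambient_hol_at (G v) F ->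
     ambient_hol_at v (fun w => (F (G w))^*)) ->
  antiholomorphic_at f (pt1 v).
Proof.
have [KG fv] := nbhs_singleton fG Kv.
move=> cG dG; split; first exact: orbit_map_continuous_at.
move=> h; rewrite fv => /(orbit_hol_atP _ act2 _ KG)[F [dF hF]].
apply/(orbit_hol_atP _ act1) => //; exists (fun w => (F (G w))^*); split.
  exact: dG.
have {}hF : nbhs v (G @^-1` [set w | K2 w -> h (pt2 w) = F w]) := cG _ hF.
by apply: filterS2 fG hF => w fGw hF /fGw [KGw /= ->]; rewrite hF.
Qed.

End OrbitMaps.

(** * Holomorphic maps between abstract spaces *)

Section Holspace.
Context {R : realType}.
Implicit Types X Y Z : holspace R.

Lemma holomorphic_comp X Y Z (f : X -> Y) (g : Y -> Z) x :
  holomorphic_at f x -> holomorphic_at g (f x) -> holomorphic_at (g \o f) x.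
Proof.
move=> [cf hf] [cg hg]; split; first exact: continuous_comp.
by move=> h /hg /hf.
Qed.

Lemma holomorphic_id X : holomorphic (@idfun X).
Proof. by move=> x; split=> // B. Qed.

Lemma regular_locus_biholomorphic X Y (A : set X) (B : set Y) (f : X -> Y) x :
  open A -> open B -> biholomorphic_on A B f -> A x ->
  @regular_locus R X x -> @regular_locus R Y (f x).
Proof.
move=> oA oB [g [fA gB hf hg]] Ax [U [V [phi [oU Ux oV [psi [phiU psiV hphi hpsi]]]]]].
have nbhsg y : B y -> U (g y) -> nbhs y (g @^-1` U).
  by move=> By Uy; apply: (hg y By).1; apply: open_nbhs_nbhs.
have nbhspsi v : V v -> A (psi v) -> nbhs v (psi @^-1` A).
  by move=> Vv Av; apply: (hpsi v Vv).1; apply: open_nbhs_nbhs.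
exists (B `&` g @^-1` U), (V `&` psi @^-1` A), (phi \o g); split.
- rewrite openE => y [By Uy]; apply: filterI; last exact: nbhsg.
  exact: open_nbhs_nbhs.
- by have [Bf gf] := fA x Ax; split => //=; rewrite gf.
- rewrite openE => v [Vv Av]; apply: filterI; last exact: nbhspsi.
  exact: open_nbhs_nbhs.
- exists (f \o psi); split.
  + move=> y [By Uy] /=; have [Ag fg] := gB y By; have [Vp pp] := phiU _ Uy.
    by rewrite pp fg; split => //; split => //=; rewrite pp.
  + move=> v [Vv Av] /=; have [Up pp] := psiV v Vv; have [Bf gf] := fA _ Av.
    by rewrite gf pp; split => //; split => //=; rewrite gf.
  + move=> y [By Uy]; apply: holomorphic_comp; [exact: hg|exact: hphi].
  + move=> v [Vv Av]; apply: holomorphic_comp; [exact: hpsi|exact: hf].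
Qed.

End Holspace.

(** * Compact boxes and zero sets *)

Section Compactness.
Context {R : realType}.
Local Notation C := (Cplx R).

Definition box : set C^o := [set z : C | `|complex.Re z| <= 1 /\ `|complex.Im z| <= 1].

Lemma norm_le1_box (z : C) : `|z| <= 1 -> box z.
Proof.
case: z => x y; rewrite normc_def lecE /= => /andP[_].
rewrite -[X in _ <= X -> _]sqrtr1 ler_sqrt // => xy.
split => /=; rewrite -[leRHS]sqrtr1 -sqrtr_sqr ler_sqrt //; apply: le_trans xy.
  by rewrite lerDl sqr_ge0.
by rewrite lerDr sqr_ge0.
Qed.

Lemma compact_box : compact box.
Proof.
pose f := fun p : R * R => Complex p.1 p.2 : C^o.
have cf : continuous f.
  move=> p B; rewrite nbhs_ballP => -[d /= d0 dB].
  have dE : d = (complex.Re d)%:C%C by apply/eqP; rewrite RRe_real ?gtr0_real.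
  have rd0 : 0 < complex.Re d by move: d0; rewrite dE ltcR.
  apply/nbhs_ballP; exists (complex.Re d / 2); first by rewrite /= divr_gt0.
  move=> q [] /=; rewrite -!ball_normE /= => h1 h2; apply: dB.
  rewrite -ball_normE /=.
  rewrite (complexE (f p - f q)) dE; apply: (le_lt_trans (ler_normD _ _)).
  have -> : `|'i%C * (complex.Im (f p - f q))%:C%C| = `|p.2 - q.2|%:C%C :> C.
    rewrite normrM !normc_def /= !(expr0n, expr1n, add0r, addr0) /=.
    by rewrite sqrtr1 sqrtr_sqr mul1r.
  have -> : `|(complex.Re (f p - f q))%:C%C| = `|p.1 - q.1|%:C%C :> C.
    by rewrite !normc_def /= !(expr0n, addr0) /= sqrtr_sqr.
  rewrite -rmorphD /= ltcR [ltRHS]splitr; exact: ltrD.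
have cI : compact ([set x : R | `|x| <= 1]).
  have -> : [set x : R | `|x| <= 1] = `[-1, 1]%classic.
    by apply/seteqP; split => x /=; rewrite in_itv /= ler_norml.
  exact: segment_compact.
suff -> : box = f @` ([set x | `|x| <= 1] `*` [set x | `|x| <= 1]).
  apply: continuous_compact; last exact: compact_setX.
  by apply: continuous_subspaceT.
apply/seteqP; split => [[x y] [/= hx hy]|_ [[x y] [/= hx hy] <-]]; last by split.
by exists (x, y).
Qed.

End Compactness.

Section Zeros.
Context {R : realType} {V : normedModType (Cplx R)}.
Local Notation C := (Cplx R).

Lemma open_neq0 (f : V -> C^o) : (forall v, differentiable f v) ->
  open [set v | f v != 0].
Proof.
move=> df; rewrite openE => v fv.
exact: (cvgr_neq0 _ (differentiable_continuous (df v)) fv).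
Qed.

Lemma closed_eq0 (f : V -> C^o) : (forall v, differentiable f v) ->
  closed [set v | f v = 0].
Proof.
move=> df; rewrite -openC.
have -> : ~` [set v | f v = 0] = [set v | f v != 0].
  by apply/seteqP; split => v /eqP.
exact: open_neq0.
Qed.

End Zeros.

(** * Proportional vectors *)

Section Proportional.
Context {F : fieldType}.

Lemma proportional2 (a b a' b' : F) : ~ (a = 0 /\ b = 0) -> ~ (a' = 0 /\ b' = 0) ->
  a * b' = b * a' -> exists2 c, c != 0 & a' = c * a /\ b' = c * b.
Proof.
move=> ab ab' E; have [a0|a0] := eqVneq a 0.
  have b0 : b != 0 by apply/eqP => b0; apply: ab.
  have a'0 : a' = 0.
    by move: E; rewrite a0 mul0r => /esym/eqP; rewrite mulf_eq0 (negPf b0) => /eqP.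
  exists (b' / b); last by rewrite a0 a'0 mulr0 divfK.
  by rewrite mulf_neq0 ?invr_eq0 //; apply/eqP => b'0; apply: ab'.
have b'E : b' = a' / a * b by rewrite mulrAC (mulrC a') -E mulrC mulKf.
exists (a' / a); last by rewrite divfK.
rewrite mulf_neq0 ?invr_eq0 //; apply/eqP => a'0; apply: ab'; split => //.
by rewrite b'E a'0 !mul0r.
Qed.

Lemma proportional3 (x y t x' y' t' : F) :
  ~ [/\ x = 0, y = 0 & t = 0] -> ~ [/\ x' = 0, y' = 0 & t' = 0] ->
  x * y' = y * x' -> x * t' = t * x' -> y * t' = t * y' ->
  exists2 d, d != 0 & [/\ x' = d * x, y' = d * y & t' = d * t].
Proof.
move=> v v' xy xt yt; have [t0|t0] := eqVneq t 0.
  have t'0 : t' = 0.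
    apply/eqP/negPn/negP => t'0; apply: v; split => //; apply/eqP.
      by move/eqP: xt; rewrite t0 mul0r mulf_eq0 (negPf t'0) orbF.
    by move/eqP: yt; rewrite t0 mul0r mulf_eq0 (negPf t'0) orbF.
  have [||d d0 [x'E y'E]] := @proportional2 x y x' y' _ _ xy.
  - by move=> [x0 y0]; apply: v.
  - by move=> [x0 y0]; apply: v'.
  by exists d => //; rewrite t0 t'0 mulr0.
have xE : x' = t' / t * x by rewrite mulrAC (mulrC t') xt mulrC mulKf.
have yE : y' = t' / t * y by rewrite mulrAC (mulrC t') yt mulrC mulKf.
exists (t' / t); last by rewrite divfK.
rewrite mulf_neq0 ?invr_eq0 //; apply/eqP => t'0; apply: v'; split => //.
  by rewrite xE t'0 !mul0r.
by rewrite yE t'0 !mul0r.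
Qed.

End Proportional.

(** * The conic bundle *)

Section Bundle.
Context {R : realType}.
Local Notation C := (Cplx R).
Variables (l : nat) (a : 'I_l.*2 -> R).
Local Notation K := (bundle_cone a).
Local Notation e := (bundle_rel (R := R) l).
Local Notation P z0 z1 := (\prod_(i < l.*2) (z1 - ofReal (a i) * z0)).

Lemma bundle_base : K (1, 0, 1, 0, 0).
Proof.
split; rewrite ?mulr0 ?expr0n ?mul0r //.
  by move=> [/eqP]; rewrite oner_eq0.
by move=> [/eqP]; rewrite oner_eq0.
Qed.

Definition bundle_origin : K := exist (fun v => v \in K) _ (mem_set bundle_base).

Definition ale_pt : bundle_vect -> ALE_surface a :=
  orbit_pt (bundle_relE l) bundle_origin.

Lemma ale_pt_surj (x : ALE_surface a) : exists2 v, K v & x = ale_pt v.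
Proof. exact: orbit_pt_surj. Qed.

Lemma ale_ptP v w : K v -> K w -> ale_pt v = ale_pt w <-> e v w.
Proof. exact: orbit_ptP. Qed.

Lemma bundle_action : orbit_action K e.
Proof.
split=> [[[[[z0 z1] x] y] t] _ [z xyt xy] [c [d [c0 d0 ->]]]|].
  split.
  - move=> [/eqP + /eqP]; rewrite !mulf_eq0 (negPf c0) /= => /eqP ? /eqP ?.
    exact: z.
  - move=> [/eqP + /eqP + /eqP]; rewrite !mulf_eq0 expf_eq0 (negPf c0) (negPf d0) /=.
    by rewrite andbF /= => /eqP ? /eqP ? /eqP ?; apply: xyt.
  - have -> : \prod_(i < l.*2) (c * z1 - ofReal (a i) * (c * z0)) = c ^+ l.*2 * P z0 z1.
      rewrite -[X in c ^+ X]card_ord -prodr_const -big_split /=.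
      by apply: eq_bigr => i _; rewrite mulrBr (mulrCA c).
    have -> : c ^+ l.*2 = c ^+ l * c ^+ l by rewrite -addnn exprD.
    rewrite mulrACA xy exprMn; ring.
move=> v w [c [d [c0 d0]]] E.
exists (fun u => (c * u.1.1.1.1, c * u.1.1.1.2, c ^+ l * d * u.1.1.2,
   c ^+ l * d * u.1.2, d * u.2)); split.
- by move: v E => [[[[z0 z1] x] y] t] ->.
- by move=> [[[[z0 z1] x] y] t]; exists c, d; split.
- by move=> u; diff.
Qed.

(** Two orbits agree iff all the minors below vanish; in those that mix fibre coordinates of
    different weights the powers of the base coordinates restore the homogeneity. *)
Lemma ale_hausdorff : hausdorff_space (ALE_surface a).
Proof.
apply: (orbit_hausdorff bundle_origin bundle_action).
move=> [[[[z0 z1] x] y] t] [[[[z0' z1'] x'] y'] t'] [z xyt xy] [z' xyt' xy'] ne.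
have sep (Phi : bundle_vect * bundle_vect -> C^o) :
    (forall u, differentiable Phi u) ->
    Phi (z0, z1, x, y, t, (z0', z1', x', y', t')) != 0 ->
    (forall v' w', e v' w' -> Phi (v', w') = 0) ->
    exists Phi : bundle_vect * bundle_vect -> C^o,
    [/\ {for (z0, z1, x, y, t, (z0', z1', x', y', t')), continuous Phi},
        Phi (z0, z1, x, y, t, (z0', z1', x', y', t')) != 0 &
        forall v' w', e v' w' -> Phi (v', w') = 0].
  move=> dPhi Phi0 Phie; exists Phi; split => //.
  exact: differentiable_continuous.
have [zE|zN] := eqVneq (z0 * z1') (z1 * z0'); last first.
  apply: (sep (fun u => u.1.1.1.1.1 * u.2.1.1.1.2 - u.1.1.1.1.2 * u.2.1.1.1.1)).
  - by move=> u; diff.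
  - by rewrite /= subr_eq0.
  - by move=> [[[[v0 v1] vx] vy] vt] _ [c [d [c0 d0 ->]]] /=; ring.
have [xyE|xyN] := eqVneq (x * y') (y * x'); last first.
  apply: (sep (fun u => u.1.1.1.2 * u.2.1.2 - u.1.1.2 * u.2.1.1.2)).
  - by move=> u; diff.
  - by rewrite /= subr_eq0.
  - by move=> [[[[v0 v1] vx] vy] vt] _ [c [d [c0 d0 ->]]] /=; ring.
have [xt0|xN] := eqVneq (z0' ^+ l * x * t') (z0 ^+ l * t * x'); last first.
  apply: (sep (fun u => u.2.1.1.1.1 ^+ l * u.1.1.1.2 * u.2.2
                        - u.1.1.1.1.1 ^+ l * u.1.2 * u.2.1.1.2)).
  - by move=> u; diff.
  - by rewrite /= subr_eq0.
  - by move=> [[[[v0 v1] vx] vy] vt] _ [c [d [c0 d0 ->]]] /=; rewrite exprMn; ring.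
have [xt1|xN] := eqVneq (z1' ^+ l * x * t') (z1 ^+ l * t * x'); last first.
  apply: (sep (fun u => u.2.1.1.1.2 ^+ l * u.1.1.1.2 * u.2.2
                        - u.1.1.1.1.2 ^+ l * u.1.2 * u.2.1.1.2)).
  - by move=> u; diff.
  - by rewrite /= subr_eq0.
  - by move=> [[[[v0 v1] vx] vy] vt] _ [c [d [c0 d0 ->]]] /=; rewrite exprMn; ring.
have [yt0|xN] := eqVneq (z0' ^+ l * y * t') (z0 ^+ l * t * y'); last first.
  apply: (sep (fun u => u.2.1.1.1.1 ^+ l * u.1.1.2 * u.2.2
                        - u.1.1.1.1.1 ^+ l * u.1.2 * u.2.1.2)).
  - by move=> u; diff.
  - by rewrite /= subr_eq0.
  - by move=> [[[[v0 v1] vx] vy] vt] _ [c [d [c0 d0 ->]]] /=; rewrite exprMn; ring.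
have [yt1|xN] := eqVneq (z1' ^+ l * y * t') (z1 ^+ l * t * y'); last first.
  apply: (sep (fun u => u.2.1.1.1.2 ^+ l * u.1.1.2 * u.2.2
                        - u.1.1.1.1.2 ^+ l * u.1.2 * u.2.1.2)).
  - by move=> u; diff.
  - by rewrite /= subr_eq0.
  - by move=> [[[[v0 v1] vx] vy] vt] _ [c [d [c0 d0 ->]]] /=; rewrite exprMn; ring.
have [c c0 [z0'E z1'E]] := proportional2 z z' zE.
exfalso; apply: ne.
(* the fibre equations are multiplied by a power of a nonvanishing coordinate of the base *)
have fib (s s' : C) : z0' ^+ l * s * t' = z0 ^+ l * t * s' ->
    z1' ^+ l * s * t' = z1 ^+ l * t * s' -> c ^+ l * s * t' = t * s'.
  move=> E0 E1; have [z00|z00] := eqVneq z0 0; last first.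
    apply: (mulfI (expf_neq0 l z00)); transitivity (z0' ^+ l * s * t').
      by rewrite z0'E exprMn; ring.
    by rewrite E0; ring.
  have z10 : z1 != 0 by apply/eqP => z10; apply: z.
  apply: (mulfI (expf_neq0 l z10)); transitivity (z1' ^+ l * s * t').
      by rewrite z1'E exprMn; ring.
    by rewrite E1; ring.
have [||||d d0 [x'E y'E t'E]] :=
    @proportional3 _ (c ^+ l * x) (c ^+ l * y) t x' y' t' _ xyt'.
- move=> [/eqP + /eqP]; rewrite !mulf_eq0 expf_eq0 (negPf c0) andbF /=.
  by move=> /eqP x0 /eqP y0 t0; apply: xyt.
- by rewrite -!mulrA xyE.
- exact: fib.
- exact: fib.
exists c, d; split => //.
by rewrite z0'E z1'E x'E y'E t'E; congr (_, _, _, _, _); ring.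
Qed.

End Bundle.

Section PairRow.
Context {R : realType}.
Local Notation C := (Cplx R).

Definition pair_row (x y : C) : 'rV[C]_2 := \row_k if k == 0 then x else y.

Lemma pair_row0 x y : pair_row x y 0 0 = x. Proof. by rewrite mxE. Qed.
Lemma pair_row1 x y : pair_row x y 0 1 = y. Proof. by rewrite mxE. Qed.
Definition pair_rowE := (pair_row0, pair_row1).

Lemma pair_row_eta (u : 'rV[C]_2) : pair_row (u 0 0) (u 0 1) = u.
Proof.
apply/rowP => k; rewrite mxE; case: eqP => [->//|/eqP].
by case: k => -[|[|]] // k _; congr (u 0 _); apply: val_inj.
Qed.

Lemma differentiable_pair_row (V : normedModType C) (f g : V -> C^o) v :
  differentiable f v -> differentiable g v ->
  differentiable (fun w => pair_row (f w) (g w)) v.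
Proof. by move=> df dg; apply: differentiable_rowf => k; case: (k == 0). Qed.

End PairRow.

Section BundleCharts.
Context {R : realType}.
Local Notation C := (Cplx R).
Variables (l : nat) (a : 'I_l.*2 -> R).
Local Notation K := (bundle_cone a).
Local Notation P z0 z1 := (\prod_(i < l.*2) (z1 - ofReal (a i) * z0)).

Lemma base_poly_scale (c z0 z1 : C) :
  P (c * z0) (c * z1) = c ^+ l * c ^+ l * P z0 z1.
Proof.
have -> : c ^+ l * c ^+ l = c ^+ l.*2 by rewrite -addnn exprD.
rewrite -[X in c ^+ X]card_ord -prodr_const -big_split /=.
by apply: eq_bigr => i _; rewrite mulrBr (mulrCA c).
Qed.

Lemma base_poly_div0 (z0 z1 : C) : z0 != 0 ->
  P 1 (z1 / z0) = z0^-1 ^+ l * z0^-1 ^+ l * P z0 z1.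
Proof. by move=> z00; rewrite -base_poly_scale mulVf // mulrC. Qed.

Lemma base_poly_div1 (z0 z1 : C) : z1 != 0 ->
  P (z0 / z1) 1 = z1^-1 ^+ l * z1^-1 ^+ l * P z0 z1.
Proof. by move=> z10; rewrite -base_poly_scale mulVf // (mulrC _ z0). Qed.

Let graph_eq (b t p x y : C) : b != 0 -> x != 0 -> x * y = t ^+ 2 * p ->
  (b ^+ l * t / x) ^+ 2 * (b^-1 ^+ l * b^-1 ^+ l * p) = b^-1 ^+ l * (b ^+ l / x) * y.
Proof.
move=> b0 x0 xy; rewrite exprVn; have bl := expf_neq0 l b0.
transitivity ((t ^+ 2 * p) / x ^+ 2); last rewrite -xy; field; by rewrite ?bl ?x0.
Qed.

(** Where a fibre coordinate [x] (or [y]) is nonzero the conic is the graph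
    y = t^2 P(z), so that the base coordinate and t parametrize the surface. *)
Lemma ale_regular_section (bx bz : bool) z0 z1 x y t :
  K (z0, z1, x, y, t) -> (if bz then z0 else z1) != 0 -> (if bx then x else y) != 0 ->
  @regular_locus R (ALE_surface a) (ale_pt a (z0, z1, x, y, t)).
Proof.
move=> Kv zi xj.
pose Z (w : bundle_vect) : C^o := if bz then w.1.1.1.1 else w.1.1.1.2.
pose Z' (w : bundle_vect) : C^o := if bz then w.1.1.1.2 else w.1.1.1.1.
pose X (w : bundle_vect) : C^o := if bx then w.1.1.2 else w.1.2.
pose mk (z0 z1 x y t : C) : @bundle_vect R :=
  (if bz then z0 else z1, if bz then z1 else z0,
   if bx then x else y, if bx then y else x, t).
have dZ w : differentiable Z w by rewrite /Z; case: (bz); diff.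
have dZ' w : differentiable Z' w by rewrite /Z'; case: (bz); diff.
have dX w : differentiable X w by rewrite /X; case: (bx); diff.
pose phi w := pair_row (Z' w / Z w) (Z w ^+ l * w.2 / X w).
pose q (u : 'rV[C]_2) : C := if bz then P 1 (u 0 0) else P (u 0 0) 1.
pose s (u : 'rV[C]_2) : bundle_vect := mk 1 (u 0 0) 1 (u 0 1 ^+ 2 * q u) (u 0 1).
have sK u : K (s u).
  rewrite /s /mk /q; case: (bz); case: (bx) => /=; split; rewrite ?mulr1 ?mul1r //;
    by move=> [] /eqP + /eqP; rewrite ?oner_eq0.
apply: (orbit_chart (bundle_relE l) (bundle_origin a) (bundle_action a)
  (Om := [set w | Z w != 0 /\ X w != 0]) (W := setT) (phi := phi) (s := s)) => //.
- by apply: openI; apply: open_neq0.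
- exact: openT.
- move=> w [Zw Xw]; apply: differentiable_pair_row; diff.
- move=> u; rewrite /s /mk /q.
  by case: (bz); case: (bx) => /=; diff.
- move=> [[[[v0 v1] vx] vy] vt] _ Kw [Zw Xw] [c [d [c0 d0 ->]]].
  rewrite /phi /Z /Z' /X in Zw Xw *.
  case: (bz) Zw Xw; case: (bx) => /= Zw Xw;
    (split; first by rewrite !mulf_neq0 ?expf_neq0);
    by congr pair_row; rewrite ?exprMn; field; rewrite ?Zw ?Xw ?c0 ?d0 ?expf_neq0.
- move=> u _; split; first exact: sK.
    rewrite /= /s /Z /X /mk.
    by case: (bz); case: (bx) => /=; rewrite !oner_eq0.
  rewrite -[RHS]pair_row_eta /phi /s /Z /Z' /X /mk.
  by case: (bz); case: (bx) => /=; rewrite !(divr1, expr1n, mul1r).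
- move=> [[[[v0 v1] vx] vy] vt] Kw [Zw Xw]; split => //.
  exists (Z (v0, v1, vx, vy, vt))^-1, (Z (v0, v1, vx, vy, vt) ^+ l / X (v0, v1, vx, vy, vt)).
  rewrite ?invr_eq0 ?mulf_neq0 ?expf_neq0 ?invr_eq0 //; split=> //.
  move: Kw => [_ _ xy].
  rewrite /phi /s /Z /Z' /X /mk /q in Zw Xw *.
  case: (bz) Zw Xw; case: (bx) => /= Zw Xw.
  all: have bl : forall b : C, b != 0 -> b^-1 ^+ l * b ^+ l = 1
    by move=> b b0; rewrite -exprMn mulVf ?expr1n.
  all: rewrite !pair_rowE ?(base_poly_div0 _ Zw) ?(base_poly_div1 _ Zw).
  all: rewrite ?(graph_eq Zw Xw xy) ?(graph_eq Zw Xw (etrans (mulrC _ _) xy)).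
  all: rewrite ?mulVf //; congr (_, _, _, _, _); rewrite ?(mulrC v0^-1) ?(mulrC v1^-1) //.
  all: by [rewrite mulrA bl // mul1r mulVf | rewrite mulrAC].
Qed.

(** At a vertex of a singular conic x = y = 0 and z is one of the [a i]; there
    the equation reads x y = (z - a_i) R(z) with R nonvanishing, so x and y / R(z)
    are coordinates. *)
Lemma ale_regular_node i z0 z1 x y t :
  injective a ->
  K (z0, z1, x, y, t) -> x = 0 -> y = 0 -> z1 = ofReal (a i) * z0 ->
  @regular_locus R (ALE_surface a) (ale_pt a (z0, z1, x, y, t)).
Proof.
move=> inja Kv x0 y0 z1E.
pose Q (w0 w1 : C) : C := \prod_(j < l.*2 | j != i) (w1 - ofReal (a j) * w0).
pose N := #|[pred j : 'I_l.*2 | j != i]|.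
have QZ c w0 w1 : Q (c * w0) (c * w1) = c ^+ N * Q w0 w1.
  rewrite /Q -prodr_const -big_split /=.
  by apply: eq_bigr => j _; rewrite mulrBr (mulrCA c).
have PQ w0 w1 : P w0 w1 = (w1 - ofReal (a i) * w0) * Q w0 w1 by rewrite (bigD1 i).
have Q1 w0 w1 : w0 != 0 -> Q 1 (w1 / w0) = w0^-1 ^+ N * Q w0 w1.
  by move=> w00; rewrite -QZ mulVf // mulrC.
pose Om : set (@bundle_vect R) := [set w | w.1.1.1.1 != 0 /\
  (w.2 != 0 /\ Q w.1.1.1.1 w.1.1.1.2 != 0)].
pose phi (w : @bundle_vect R) := pair_row (w.1.1.2 / (w.2 * w.1.1.1.1 ^+ l))
  (w.1.2 * w.1.1.1.1 ^+ N / (w.2 * w.1.1.1.1 ^+ l * Q w.1.1.1.1 w.1.1.1.2)).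
pose zz (u : 'rV[C]_2) : C := ofReal (a i) + u 0 0 * u 0 1.
pose s (u : 'rV[C]_2) : @bundle_vect R := (1, zz u, u 0 0, u 0 1 * Q 1 (zz u), 1).
have bl (b : C) n : b != 0 -> b^-1 ^+ n * b ^+ n = 1.
  by move=> b0; rewrite -exprMn mulVf ?expr1n.
apply: (orbit_chart (bundle_relE l) (bundle_origin a) (bundle_action a)
  (Om := Om) (W := [set u | Q 1 (zz u) != 0]) (phi := phi) (s := s)) => //.
- apply: openI; first by apply: open_neq0 => w; diff.
  by apply: openI; apply: open_neq0 => w; rewrite /Q; diff.
- by apply: open_neq0 => u; rewrite /Q /zz; diff.
- move=> w [w0 [wt wQ]]; rewrite /phi; apply: differentiable_pair_row; rewrite /Q; diff.
  by rewrite mulf_neq0 ?expf_neq0.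
  by rewrite !mulf_neq0 ?expf_neq0.
- by move=> u; rewrite /s /zz /Q; diff.
- move=> [[[[v0 v1] vx] vy] vt] _ Kw [/= w0 [wt wQ]] [c [d [c0 d0 ->]]]; split.
    by rewrite /Om /= QZ !mulf_neq0 ?expf_neq0.
  rewrite /phi /= QZ !exprMn; congr pair_row; field.
    by rewrite !expf_neq0 ?w0 ?c0 ?d0 ?wt.
  by rewrite !expf_neq0 ?w0 ?c0 ?d0 ?wt ?wQ.
- move=> u /= Qu; split.
  + split; rewrite ?oner_eq0.
    * by move=> [/eqP]; rewrite oner_eq0.
    * by move=> [_ _ /eqP]; rewrite oner_eq0.
    * by rewrite PQ /zz expr1n mul1r mulr1 (addrC (ofReal _)) addrK; ring.
  + by rewrite /Om /= oner_eq0.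
  + rewrite -[RHS]pair_row_eta /phi /= !expr1n !mulr1 !mul1r invr1 mulr1.
    by rewrite mulfK.
- move=> [[[[v0 v1] vx] vy] vt] [_ _ xy] [/= w0 [wt wQ]].
  have zzE : zz (phi (v0, v1, vx, vy, vt)) = v1 / v0.
    rewrite /zz /phi /= !pair_rowE.
    move: xy; rewrite PQ => xy.
    have lN : v0 ^+ l * v0 ^+ l = v0 * v0 ^+ N.
      have -> : N = l.*2.-1 by rewrite /N (eq_card (B := predC1 i)) // cardC1 card_ord.
      rewrite -exprD addnn -exprS prednK //.
      exact: leq_ltn_trans (ltn_ord i).
    have -> : vx / (vt * v0 ^+ l) * (vy * v0 ^+ N / (vt * v0 ^+ l * Q v0 v1)) =
        vx * vy * v0 ^+ N / (vt ^+ 2 * (v0 ^+ l * v0 ^+ l) * Q v0 v1).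
      by field; rewrite ?expf_neq0 ?wt ?wQ ?w0.
    by rewrite xy lN; field; rewrite ?expf_neq0 ?wt ?wQ ?w0.
  rewrite /= zzE Q1 //; split; first by rewrite mulf_neq0 ?expf_neq0 ?invr_eq0.
  exists v0^-1, vt^-1; rewrite !invr_eq0; split => //.
  rewrite /s zzE Q1 // /phi /= !pair_rowE !mulVf // (mulrC v0^-1).
  congr (_, _, _, _, _).
    by rewrite exprVn; field; rewrite ?expf_neq0 ?w0 ?wt.
  by rewrite !exprVn; field; rewrite ?expf_neq0 ?w0 ?wt.
- have z00 : z0 != 0.
    by apply/eqP => z00; case: Kv => z _ _; apply: z; rewrite z1E z00 mulr0.
  split => //; split.
    by apply/eqP => t0; case: Kv => _ xyt _; apply: xyt.
  rewrite /Q /= z1E; apply/prodf_neq0 => j ji.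
  rewrite -mulrBl mulf_neq0 // subr_eq0; apply: contraNN ji => /eqP/complexI/inja ->.
  by [].
Qed.

End BundleCharts.

Lemma exists_max_norm (F : numDomainType) (x : F) (s : seq F) :
  exists2 z, z \in x :: s & {in x :: s, forall w, `|w| <= `|z|}.
Proof.
elim: s x => [|y s ih] x; first by exists x => [|w]; rewrite inE // => /eqP ->.
have [z zs zM] := ih y.
have [xz|zx] := real_leP (normr_real x) (normr_real z).
- exists z => [|w]; first by rewrite inE zs orbT.
  by rewrite inE => /predU1P[-> //|]; exact: zM.
- exists x => [|w]; first by rewrite inE eqxx.
  by rewrite inE => /predU1P[-> //|/zM wz]; exact: le_trans wz (ltW zx).
Qed.

Lemma exists_normalization (F : numFieldType) (x : F) (s : seq F) :
  has (fun w => w != 0) (x :: s) ->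
  exists2 c, c != 0 & (exists2 z, z \in x :: s & c * z = 1) /\
    {in x :: s, forall w, `|c * w| <= 1}.
Proof.
move=> /hasP[u us u0]; have [z zs zM] := exists_max_norm x s.
have z0 : z != 0.
  by rewrite -normr_gt0; apply: lt_le_trans (zM _ us); rewrite normr_gt0.
exists z^-1; first by rewrite invr_eq0.
split; first by exists z => //; rewrite mulVf.
move=> w ws; rewrite normrM normfV mulrC ler_pdivrMr ?normr_gt0 // mul1r.
exact: zM.
Qed.

Section AleGlobal.
Context {R : realType}.
Local Notation C := (Cplx R).
Variables (l : nat) (a : 'I_l.*2 -> R).
Local Notation K := (bundle_cone a).
Local Notation e := (bundle_rel (R := R) l).
Local Notation P z0 z1 := (\prod_(i < l.*2) (z1 - ofReal (a i) * z0)).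

Lemma ale_complex_surface : injective a -> complex_surface (ALE_surface a).
Proof.
move=> inja; split; first exact: ale_hausdorff.
move=> p; have [[[[[z0 z1] x] y] t] Kv ->] := ale_pt_surj p.
have zN : z0 != 0 \/ z1 != 0.
  have [z00|] := eqVneq z0 0; [right|by left].
  by apply/eqP => z10; case: Kv => z _ _; apply: z.
have [x0|x0] := eqVneq x 0; last first.
  by case: zN => z0N; [apply: (ale_regular_section (bx := true) (bz := true))
                      |apply: (ale_regular_section (bx := true) (bz := false))].
have [y0|y0] := eqVneq y 0; last first.
  by case: zN => z0N; [apply: (ale_regular_section (bx := false) (bz := true))
                      |apply: (ale_regular_section (bx := false) (bz := false))].
have [_ xyt xy] := Kv.
have : t ^+ 2 * P z0 z1 == 0 by rewrite -xy x0 mul0r.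
rewrite mulf_eq0 expf_eq0 /=.
have -> /= : (t == 0) = false by apply/eqP => t0; apply: xyt.
move=> /prodf_eq0[i _]; rewrite subr_eq0 => /eqP z1E.
exact: (ale_regular_node inja Kv x0 y0 z1E).
Qed.

(** Every orbit has a representative in a product of boxes one of whose base
    coordinates, and one of whose fibre coordinates, is 1. *)
Lemma ale_compact : compact [set: ALE_surface a].
Proof.
pose N : set (@bundle_vect R) := [set v |
  [/\ (((((box `*` box) `*` box) `*` box) `*` box) v),
      (v.1.1.1.1 - 1) * (v.1.1.1.2 - 1) = 0,
      (v.1.1.2 - 1) * (v.1.2 - 1) * (v.2 - 1) = 0 &
      v.1.1.2 * v.1.2 - v.2 ^+ 2 * P v.1.1.1.1 v.1.1.1.2 = 0]].
have NK : N `<=` K.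
  move=> [[[[z0 z1] x] y] t] [_ /eqP + /eqP + /eqP] /=.
  rewrite !mulf_eq0 !subr_eq0 => /orP zz1 /orP xyt1 /eqP xy; split => //.
    by move=> [z00 z10]; case: zz1; rewrite ?z00 ?z10 eq_sym oner_eq0.
  move=> [x0 y0 t0]; case: xyt1 => [/orP[]|];
    by rewrite ?x0 ?y0 ?t0 eq_sym oner_eq0.
have cN : compact N.
  have -> : N = ((((box `*` box) `*` box) `*` box) `*` box) `&`
     ([set v | (v.1.1.1.1 - 1) * (v.1.1.1.2 - 1) = 0 :> C^o] `&`
      ([set v | (v.1.1.2 - 1) * (v.1.2 - 1) * (v.2 - 1) = 0 :> C^o] `&`
       [set v | v.1.1.2 * v.1.2 - v.2 ^+ 2 * P v.1.1.1.1 v.1.1.1.2 = 0 :> C^o])).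
    by apply/seteqP; split=> [v []|v [? [? []]]].
  apply: compact_closedI.
    by do 4! [apply: compact_setX; last exact: compact_box]; exact: compact_box.
  apply: closedI; first by apply: closed_eq0 => v; diff.
  by apply: closedI; apply: closed_eq0 => v; diff.
have <- : @ale_pt R l a @` N = [set: ALE_surface a].
  apply/seteqP; split => // p _; have [[[[[z0 z1] x] y] t] Kv ->] := ale_pt_surj p.
  have [c [c0 cz1 c0' c1']] : exists c : C, [/\ c != 0,
      (c * z0 - 1) * (c * z1 - 1) = 0, `|c * z0| <= 1 & `|c * z1| <= 1].
    have [|c c0 [[z zs cz] cM]] := @exists_normalization C z0 [:: z1].
      rewrite /= orbF -negb_and; apply/negP => /andP[/eqP z00 /eqP z10].
      by case: Kv => z _ _; apply: z.
    exists c; split; rewrite ?cM ?inE ?eqxx ?orbT //.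
    by move: zs cz; rewrite !inE => /orP[] /eqP -> ->; rewrite subrr ?mul0r ?mulr0.
  have [d [d0 d1 dx dy dt]] : exists d : C, [/\ d != 0,
      (d * (c ^+ l * x) - 1) * (d * (c ^+ l * y) - 1) * (d * t - 1) = 0,
      `|d * (c ^+ l * x)| <= 1, `|d * (c ^+ l * y)| <= 1 & `|d * t| <= 1].
    have [|d d0 [[z zs cz] cM]] := @exists_normalization C (c ^+ l * x) [:: c ^+ l * y; t].
      rewrite /= orbF !mulf_eq0 !expf_eq0 (negPf c0) !andbF /= -!negb_and.
      apply/negP => /and3P[/eqP x0 /eqP y0 /eqP t0].
      by case: Kv => _ xyt _; apply: xyt.
    exists d; split; rewrite ?cM ?inE ?eqxx ?orbT //.
    move: zs cz; rewrite !inE => /or3P[] /eqP -> ->;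
      by rewrite subrr ?mul0r ?mulr0 ?mul0r.
  pose w : @bundle_vect R := (c * z0, c * z1, c ^+ l * d * x, c ^+ l * d * y, d * t).
  have evw : e (z0, z1, x, y, t) w by exists c, d; split.
  have Kw := (bundle_action a).1 _ _ Kv evw.
  exists w; last by apply/esym/ale_ptP.
  have [_ _ xyw] := Kw.
  split => //=.
  - rewrite !(mulrAC _ d) !(mulrC _ d).
    by do 4! [split => /=; last by apply: norm_le1_box]; apply: norm_le1_box.
  - by rewrite !(mulrAC _ d) !(mulrC _ d).
  - by rewrite xyw subrr.
apply: continuous_compact => //; apply/subspace_continuousP => v Nv B Bv.
have := orbit_pt_continuous (NK _ Nv) Bv.
by apply: filterS => w KB Nw; apply/KB/NK.
Qed.

Lemma tau_ptE v : K v -> tau a (ale_pt a v) = ale_pt a (tau_vect l v).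
Proof.
move=> Kv; apply: tauE; rewrite !val_orbit_pt //.
exact: tau_cone.
Qed.

Lemma conj_signM (x : C) : ((-1) ^+ l * x^*)^* = (-1) ^+ l * x.
Proof.
by rewrite rmorphM /= rmorphXn /= rmorphN1; congr (_ * _); exact: conjCK.
Qed.

Lemma tau_vectK : involutive (@tau_vect R l).
Proof.
move=> [[[[z0 z1] x] y] t]; rewrite /tau_vect !conj_signM !conjCK.
by rewrite !mulrA -expr2 sqrr_sign !mul1r.
Qed.

Lemma tau_vectD (u w : @bundle_vect R) : tau_vect l (u + w) = tau_vect l u + tau_vect l w.
Proof.
move: u w => [[[[u0 u1] u2] u3] u4] [[[[w0 w1] w2] w3] w4].
have D (x y : C) : (-1) ^+ l * (x + y)^* = (-1) ^+ l * x^* + (-1) ^+ l * y^*.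
  by rewrite rmorphD mulrDr.
change (((u0 + w0 : C)^*, (u1 + w1 : C)^*, (-1) ^+ l * (u3 + w3 : C)^*, 
    (-1) ^+ l * (u2 + w2 : C)^*, (u4 + w4 : C)^*) =
   ((u0 : C)^* + (w0 : C)^*, (u1 : C)^* + (w1 : C)^*, 
    (-1) ^+ l * (u3 : C)^* + (-1) ^+ l * (w3 : C)^*,
    (-1) ^+ l * (u2 : C)^* + (-1) ^+ l * (w2 : C)^*, (u4 : C)^* + (w4 : C)^*) :> C * C * C * C * C).
by rewrite !D -!rmorphD.
Qed.

Lemma tau_vectZ c (u : @bundle_vect R) : tau_vect l (c *: u) = c^* *: tau_vect l u.
Proof.
move: u => [[[[u0 u1] u2] u3] u4].
have D (x : C) : (-1) ^+ l * (c * x)^* = c^* * ((-1) ^+ l * x^*).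
  by rewrite rmorphM mulrCA.
change (((c * u0 : C)^*, (c * u1 : C)^*, (-1) ^+ l * (c * u3 : C)^*,
    (-1) ^+ l * (c * u2 : C)^*, (c * u4 : C)^*) =
   (c^* * (u0 : C)^*, c^* * (u1 : C)^*, c^* * ((-1) ^+ l * (u3 : C)^*),
    c^* * ((-1) ^+ l * (u2 : C)^*), c^* * (u4 : C)^*) :> C * C * C * C * C).
by rewrite !D -!rmorphM.
Qed.

Lemma norm_bundle_le (z0 z1 x y t M : C) :
  (`|(z0, z1, x, y, t) : @bundle_vect R| <= M) =
  [&& `|z0| <= M, `|z1| <= M, `|x| <= M, `|y| <= M & `|t| <= M].
Proof.
rewrite (norm_pair_le (_, _ : C^o)) (norm_pair_le (_, _ : C^o)).
rewrite (norm_pair_le (_, _ : C^o)) (norm_pair_le (_ : C^o, _ : C^o)) -!andbA.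
by [].
Qed.

Lemma tau_vect_le (u : @bundle_vect R) : `|tau_vect l u| <= `|u|.
Proof.
move: u => [[[[u0 u1] u2] u3] u4].
have D (x : C) : `|(-1) ^+ l * x^*| = `|x|.
  by rewrite normrM normrX normrN1 expr1n mul1r norm_conjC.
have := lexx `|(u0, u1, u2, u3, u4) : @bundle_vect R|.
rewrite {1}norm_bundle_le => /and5P[h0 h1 h2 h3 h4].
rewrite /tau_vect norm_bundle_le !D !norm_conjC.
by apply/and5P.
Qed.

Lemma tau_real_structure : real_structure (tau a).
Proof.
split=> p; have [v Kv ->] := ale_pt_surj p.
  rewrite tau_ptE // tau_ptE; last exact: tau_cone.
  by rewrite tau_vectK.
apply: (orbit_map_antiholomorphic_at (bundle_action a) (bundle_action a) Kv
  (k2 := bundle_origin a) (G := tau_vect l)).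
- by apply: filterE => w Kw; split; [exact: tau_cone|exact: tau_ptE].
- exact: (antilinear_continuous tau_vectD tau_vectZ tau_vect_le).
- move=> F; exact: (ambient_hol_conj tau_vectD tau_vectZ tau_vect_le).
Qed.

End AleGlobal.

(** * The minitwistor space *)

Section Minitwistor.
Context {R : realType}.
Local Notation C := (Cplx R).
Variables (g : nat) (Q : 'M[R]_g.+2).
Local Notation K := (minitwistor_cone Q).
Local Notation e := (homothety (R := R) (g := g)).

Lemma quad_formZ c (X : 'rV[C]_g.+2) : quad_form Q (c *: X) = c ^+ 2 * quad_form Q X.
Proof.
rewrite /quad_form mulr_sumr; apply: eq_bigr => i _.
rewrite mulr_sumr; apply: eq_bigr => j _; rewrite !mxE; ring.
Qed.

Lemma minitwistor_base : K (0, 1, 'i).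
Proof.
split.
- by case=> _ /eqP; rewrite oner_eq0.
- by exists 0, 0, 0 => i; rewrite mxE !mul0r.
- by rewrite -[X in quad_form Q X](scale0r 0) quad_formZ expr0n mul0r expr1n sub0r sqrCi.
Qed.

Definition minitwistor_origin : K := exist (fun v => v \in K) _ (mem_set minitwistor_base).

Definition minitwistor_pt : @minitwistor_vect R g -> minitwistor Q :=
  orbit_pt (homothetyE g) minitwistor_origin.

Lemma minitwistor_pt_surj (x : minitwistor Q) : exists2 v, K v & x = minitwistor_pt v.
Proof. exact: orbit_pt_surj. Qed.

Lemma minitwistor_ptP v w : K v -> K w -> minitwistor_pt v = minitwistor_pt w <-> e v w.
Proof. exact: orbit_ptP. Qed.

Lemma minitwistor_action : orbit_action K e.
Proof.
split=> [[[X W] Y] _ [v0 [d [s [t Xe]]] YW] [c c0 ->]|v w [c c0 ->]].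
  split.
  - by move=> /eqP; rewrite scaler_eq0 (negPf c0) => /eqP.
  - by exists (c * d), s, t => i; rewrite mxE Xe !mulrA.
  - by rewrite quad_formZ !exprMn YW mulrBr.
exists (fun u => c *: u); split => // u; by exists c.
Qed.

Definition twistor_coord (k : 'I_g.+2 + bool) (v : @minitwistor_vect R g) : C^o :=
  match k with inl i => v.1.1 0 i | inr b => if b then v.1.2 else v.2 end.

Lemma twistor_coordZ k c v : twistor_coord k (c *: v) = c * twistor_coord k v.
Proof. by case: k => [i|[]] //=; rewrite mxE. Qed.

Lemma twistor_coord_inj v w : (forall k, twistor_coord k v = twistor_coord k w) -> v = w.
Proof.
move: v w => [[X W] Y] [[X' W'] Y'] E; congr (_, _, _).
- by apply/rowP => i; exact: (E (inl i)).
- exact: (E (inr true)).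
- exact: (E (inr false)).
Qed.

Lemma minitwistor_hausdorff : hausdorff_space (minitwistor Q).
Proof.
apply: (orbit_hausdorff minitwistor_origin minitwistor_action) => v w Kv Kw ne.
apply: contrapT => sep; apply: ne.
have {}sep j k : twistor_coord j v * twistor_coord k w = twistor_coord k v * twistor_coord j w.
  apply/eqP/negPn/negP => jk; apply: sep.
  exists (fun u => twistor_coord j u.1 * twistor_coord k u.2 -
                   twistor_coord k u.1 * twistor_coord j u.2); split.
  - apply: differentiable_continuous.
    by case: j {jk} => [i|[]]; case: k => [i'|[]] /=; diff.
  - by rewrite /= subr_eq0.
  - by move=> v' _ [c c0 ->]; rewrite /= !twistor_coordZ; ring.
have nz u : K u -> exists j, twistor_coord j u != 0.
  move: u => [[X W] Y] [u0 _ _]; apply: contrapT => nz; apply: u0.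
  apply: twistor_coord_inj => k; have -> : twistor_coord k 0 = 0.
    by case: k => [i|[]] //=; rewrite mxE.
  by apply/eqP/negPn/negP => kn; apply: nz; exists k.
have [j vj] := nz _ Kv; have [k wk] := nz _ Kw.
have cE : w = (twistor_coord j w / twistor_coord j v) *: v.
  apply: twistor_coord_inj => i; rewrite twistor_coordZ.
  by rewrite mulrAC (mulrC (twistor_coord j w)) -sep mulrC mulKf.
exists (twistor_coord j w / twistor_coord j v) => //.
by apply/eqP => c0; move: wk; rewrite cE c0 scale0r; case: k => [i|[]] /=; rewrite ?mxE eqxx.
Qed.

End Minitwistor.

(** * The contraction of the two sections at infinity *)

Section Comparison.
Context {R : realType}.
Local Notation C := (Cplx R).
Variables (n : nat) (a : 'I_n.+1.*2 -> R) (Q : 'M[R]_n.+2) (m rho : R).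
Local Notation P z0 z1 := (\prod_(i < n.+1.*2) (z1 - ofReal (a i) * z0)).
Local Notation KS := (bundle_cone a).
Local Notation KT := (minitwistor_cone Q).
Local Notation eS := (bundle_rel (R := R) n.+1).
Local Notation eT := (homothety (R := R) (g := n)).
Local Notation ptS := (ale_pt a).
Local Notation ptT := (minitwistor_pt Q).
Local Notation eps := ((-1) ^+ n.+1 : C).

(** A point of the cone over the rational normal curve. *)
Definition veronese (t u0 u1 : C) : 'rV[C]_n.+2 :=
  \row_i (t * u0 ^+ (n.+1 - i) * u1 ^+ i).

(** The linear form vanishing at z = m. With [z0] as second coordinate it gives the base
    coordinate z0 / (m z0 - z1), for which m is the point at infinity. *)
Definition infty_form (z0 z1 : C) : C := ofReal m * z0 - z1.

Hypothesis rho0 : rho != 0.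
Hypothesis quad_formE : forall z0 z1 t : C,
  quad_form Q (veronese t (infty_form z0 z1) z0) = eps * ofReal rho ^+ 2 * (t ^+ 2 * P z0 z1).

Let r0 : ofReal rho != 0 :> C.
Proof. by apply/eqP => /complexI/eqP; exact/negP. Qed.

Let i0 : 'i != 0 :> C. Proof. exact: neq0Ci. Qed.
Let epsE : eps * eps = 1. Proof. by rewrite -expr2 sqrr_sign. Qed.

(** Up to the factor rho and the sign [eps], x and y are W + iY and W - iY; this sign lets the
    real structure exchanging x and y be the conjugation of W and Y. *)
Definition fibW (x y : C) : C := ofReal rho * (x + eps * y) / 2.
Definition fibY (x y : C) : C := ofReal rho * (x - eps * y) / (2 * 'i).
Definition fibX (W Y : C) : C := (W + 'i * Y) / ofReal rho.
Definition fibX' (W Y : C) : C := eps * (W - 'i * Y) / ofReal rho.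

Lemma fibXK x y : fibX (fibW x y) (fibY x y) = x.
Proof. rewrite /fibX /fibW /fibY; field; by rewrite i0 r0. Qed.

Lemma fibX'K x y : fibX' (fibW x y) (fibY x y) = y.
Proof.
transitivity (eps * eps * y); last by rewrite epsE mul1r.
by rewrite /fibX' /fibW /fibY; field; rewrite i0 r0.
Qed.

Lemma fibWK W Y : fibW (fibX W Y) (fibX' W Y) = W.
Proof.
rewrite /fibX' /fibX /fibW !mulrA epsE; field; by rewrite r0.
Qed.

Lemma fibYK W Y : fibY (fibX W Y) (fibX' W Y) = Y.
Proof.
rewrite /fibX' /fibX /fibY !mulrA epsE; field; by rewrite r0 i0.
Qed.

Lemma fib_quad W Y : fibX W Y * fibX' W Y = eps * (W ^+ 2 + Y ^+ 2) / ofReal rho ^+ 2.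
Proof.
have ii : 'i * 'i = -1 :> C by rewrite -expr2 sqrCi.
rewrite /fibX /fibX'.
transitivity (eps * (W ^+ 2 - ('i * 'i) * Y ^+ 2) / ofReal rho ^+ 2).
  by field; rewrite r0.
by rewrite ii mulN1r opprK.
Qed.

Lemma fib_scale c x y x' y' : fibW x' y' = c * fibW x y -> fibY x' y' = c * fibY x y ->
  x' = c * x /\ y' = c * y.
Proof.
move=> EW EY; split.
  by rewrite -(fibXK x' y') EW EY -[in RHS](fibXK x y) /fibX; ring.
by rewrite -(fibX'K x' y') EW EY -[in RHS](fibX'K x y) /fibX'; ring.
Qed.

(** All these coordinates are multiplied by c^l d when the base coordinates are multiplied by
    c and t by d, so that they define a map to the projective space. *)
Definition resol_vect (v : @bundle_vect R) : @minitwistor_vect R n :=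
  let: (z0, z1, x, y, t) := v in (veronese t (infty_form z0 z1) z0, fibW x y, fibY x y).

Definition unresol_vect (t u0 u1 W Y : C) : @bundle_vect R :=
  (u1, ofReal m * u1 - u0, fibX W Y, fibX' W Y, t).

Lemma infty_form_inv u0 u1 : infty_form u1 (ofReal m * u1 - u0) = u0.
Proof. rewrite /infty_form; ring. Qed.

Lemma infty_form_eq0 z0 z1 : infty_form z0 z1 = 0 -> z0 = 0 -> z1 = 0.
Proof. by move=> /[swap] ->; rewrite /infty_form mulr0 sub0r => /eqP; rewrite oppr_eq0 => /eqP. Qed.

Lemma veronese_eq0 t u0 u1 : veronese t u0 u1 = 0 -> t = 0 \/ (u0 = 0 /\ u1 = 0).
Proof.
move=> /rowP E; have [t0|t0] := eqVneq t 0; [by left|right; split; apply/eqP].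
  move: (E ord0); rewrite !mxE expr0 subn0 mulr1 => /eqP.
  by rewrite mulf_eq0 (negPf t0) expf_eq0.
move: (E ord_max); rewrite !mxE /= subnn expr0 mulr1 => /eqP.
by rewrite mulf_eq0 (negPf t0) expf_eq0.
Qed.

Lemma resol_vect_cone v : KS v -> KT (resol_vect v).
Proof.
move: v => [[[[z0 z1] x] y] t] [z xyt xy]; split.
- move=> [E W0 Y0]; apply: xyt.
  have x0 : x = 0 by rewrite -(fibXK x y) W0 Y0 /fibX; ring.
  have y0 : y = 0 by rewrite -(fibX'K x y) W0 Y0 /fibX'; ring.
  split=> //; have [//|[u0 u1]] := veronese_eq0 E.
  by case: z; split => //; exact: infty_form_eq0 u1.
- by exists t, (infty_form z0 z1), z0 => i; rewrite mxE.
- rewrite quad_formE -xy; move: (fibW x y) (fibY x y) (fibXK x y) (fibX'K x y).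
  move=> W Y <- <-; rewrite fib_quad.
  transitivity (eps * eps * (W ^+ 2 + Y ^+ 2) - W ^+ 2).
    by rewrite epsE mul1r (addrC (W ^+ 2)) addrK.
  by field; rewrite r0.
Qed.

Lemma unresol_vect_cone t u0 u1 W Y : t != 0 -> ~ (u0 = 0 /\ u1 = 0) ->
  KT (veronese t u0 u1, W, Y) -> KS (unresol_vect t u0 u1 W Y).
Proof.
move=> t0 u [_ _ YW]; split.
- move=> [u10 /eqP]; rewrite u10 mulr0 sub0r oppr_eq0 => /eqP u00.
  exact: u.
- by move=> [_ _ /eqP]; exact/negP.
- rewrite fib_quad YW addrCA subrr addr0.
  rewrite -[X in veronese _ X _](infty_form_inv u0 u1) quad_formE.
  transitivity (eps * eps * (t ^+ 2 * P u1 (ofReal m * u1 - u0))).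
    by field; rewrite r0.
  by rewrite epsE mul1r.
Qed.

Lemma resol_unresol_vect t u0 u1 W Y :
  resol_vect (unresol_vect t u0 u1 W Y) = (veronese t u0 u1, W, Y).
Proof. by rewrite /resol_vect /unresol_vect infty_form_inv fibWK fibYK. Qed.

Lemma resol_vect_equiv v w : eS v w -> eT (resol_vect v) (resol_vect w).
Proof.
move: v => [[[[z0 z1] x] y] t] [c [d [c0 d0 ->]]].
exists (c ^+ n.+1 * d); first by rewrite mulf_neq0 ?expf_neq0.
have EX : veronese (d * t) (infty_form (c * z0) (c * z1)) (c * z0) =
    (c ^+ n.+1 * d) *: veronese t (infty_form z0 z1) z0.
  apply/rowP => i; rewrite !mxE.
  have -> : infty_form (c * z0) (c * z1) = c * infty_form z0 z1 by rewrite /infty_form; ring.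
  rewrite !exprMn -[X in c ^+ X * d](@subnK i n.+1) ?exprD; last by rewrite -ltnS.
  ring.
have EW : fibW (c ^+ n.+1 * d * x) (c ^+ n.+1 * d * y) = (c ^+ n.+1 * d) * fibW x y.
  by rewrite /fibW; ring.
have EY : fibY (c ^+ n.+1 * d * x) (c ^+ n.+1 * d * y) = (c ^+ n.+1 * d) * fibY x y.
  by rewrite /fibY; ring.
by rewrite /resol_vect EX EW EY.
Qed.

(** The points of a Veronese curve determine their parameters: the ratio of the
    first two coordinates does. *)
Lemma veronese_inj t u0 u1 t' u0' u1' : t != 0 -> t' != 0 ->
  veronese t u0 u1 = veronese t' u0' u1' -> u0 * u1' = u1 * u0'.
Proof.
move=> t0 t'0 /rowP E; have := E ord0; rewrite !mxE expr0 subn0 !mulr1 => E0.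
have [u00|u00] := eqVneq u0 0.
  move: E0; rewrite u00 expr0n mulr0 => /esym/eqP.
  by rewrite mulf_eq0 (negPf t'0) expf_eq0 /= => /eqP ->; rewrite mul0r mulr0.
have u0'0 : u0' != 0.
  apply/eqP => u0'0; move/eqP: E0; rewrite u0'0 expr0n mulr0.
  by rewrite mulf_eq0 (negPf t0) expf_eq0 /= (negPf u00).
have := E (lift ord0 ord0); rewrite !mxE /= /bump /= subn1 /= !expr1 => E1.
have nz : t * t' * u0 ^+ n * u0' ^+ n != 0 by rewrite !mulf_neq0 ?expf_neq0.
apply: (mulfI nz).
transitivity ((t * u0 ^+ n.+1) * (t' * u0' ^+ n * u1')); first by rewrite exprS; ring.
rewrite E0 -E1 exprS; ring.
Qed.

Lemma resol_vect_inj v w : KS v -> KS w -> v.2 != 0 -> eT (resol_vect v) (resol_vect w) -> eS v w.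
Proof.
move: v w => [[[[z0 z1] x] y] t] [[[[z0' z1'] x'] y'] t'] Kv Kw t0 [c c0 [EX EW EY]].
have zN : ~ (infty_form z0 z1 = 0 /\ z0 = 0).
  by case: Kv => z _ _ [h h']; apply: z; split => //; exact: infty_form_eq0 h h'.
have zN' : ~ (infty_form z0' z1' = 0 /\ z0' = 0).
  by case: Kw => z _ _ [h h']; apply: z; split => //; exact: infty_form_eq0 h h'.
have EX' : veronese t' (infty_form z0' z1') z0' = veronese (c * t) (infty_form z0 z1) z0.
  by rewrite EX; apply/rowP => i; rewrite !mxE !mulrA.
have ct0 : c * t != 0 by rewrite mulf_neq0.
have t'0 : t' != 0.
  apply/eqP => t'0; have : veronese (c * t) (infty_form z0 z1) z0 = 0.
    by rewrite -EX' t'0; apply/rowP => i; rewrite !mxE !mul0r.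
  by move=> /veronese_eq0[/eqP|//]; exact/negP.
have [k k0 [u0E u1E]] := proportional2 zN zN' (veronese_inj ct0 t'0 (esym EX')).
have z1E : z1' = k * z1.
  have -> : z1' = ofReal m * z0' - infty_form z0' z1' by rewrite /infty_form; ring.
  by rewrite u0E u1E /infty_form; ring.
have tk : t' * k ^+ n.+1 = c * t.
  move: EX' => /rowP E; have [u00|u00] := eqVneq (infty_form z0 z1) 0; last first.
    move: (E ord0); rewrite !mxE expr0 subn0 !mulr1 u0E exprMn !mulrA.
    by apply: mulIf; rewrite expf_neq0.
  have z00 : z0 != 0 by apply/eqP => z00; apply: zN.
  move: (E ord_max); rewrite !mxE /= subnn !expr0 !mulr1 u1E exprMn !mulrA.
  by apply: mulIf; rewrite expf_neq0.
have [xE yE] := fib_scale EW EY.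
exists k, (t' / t); split; rewrite ?mulf_neq0 ?invr_eq0 //.
have kc : k ^+ n.+1 * (t' / t) = c.
  by apply: (mulIf t0); rewrite -mulrA divfK // mulrC.
by rewrite kc divfK // u1E z1E xE yE.
Qed.

Definition resol (x : ALE_surface a) : minitwistor Q :=
  ptT (resol_vect (\val (orbit_repr x))).

Lemma resolE v : KS v -> resol (ptS v) = ptT (resol_vect v).
Proof.
move=> Kv; have ev := orbit_repr_ptP (bundle_relE n.+1) (bundle_origin a) Kv.
apply/esym/minitwistor_ptP; [exact: resol_vect_cone| |exact: resol_vect_equiv].
by apply: resol_vect_cone; exact: (bundle_action a).1 Kv ev.
Qed.

Lemma differentiable_resol_vect v : differentiable resol_vect v.
Proof.
have -> : resol_vect = (fun v : @bundle_vect R =>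
    (veronese v.2 (infty_form v.1.1.1.1 v.1.1.1.2) v.1.1.1.1,
     fibW v.1.1.2 v.1.2, fibY v.1.1.2 v.1.2)).
  by apply/funext => -[[[[z0 z1] x] y] t].
rewrite /veronese /infty_form /fibW /fibY; diff.
Qed.

Lemma resol_holomorphic : holomorphic resol.
Proof.
move=> x; have [v Kv ->] := ale_pt_surj x.
apply: (orbit_map_holomorphic_at (bundle_action a) (minitwistor_action Q)
  (k2 := minitwistor_origin Q) (G := resol_vect) Kv).
  by apply: filterE => w Kw; split; [exact: resol_vect_cone|exact: resolE].
by apply: filterE => w; exact: differentiable_resol_vect.
Qed.

(** The complement of the two points over the vertex of the cone. *)
Definition off_vertex : set (minitwistor Q) :=
  [set y | (\val (orbit_repr y)).1.1 != 0].

Lemma off_vertexP v : KT v -> off_vertex (ptT v) <-> v.1.1 != 0.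
Proof.
move=> Kv; have [c c0 E] := orbit_repr_ptP (homothetyE n) (minitwistor_origin Q) Kv.
rewrite /off_vertex /=.
have -> : \val (orbit_repr (ptT v)) = c *: v by exact: E.
have -> : (c *: v).1.1 = c *: v.1.1 by [].
by rewrite scaler_eq0 (negPf c0).
Qed.

Lemma open_off_vertex : open off_vertex.
Proof.
rewrite openE => y; have [v Kv ->] := minitwistor_pt_surj y.
move=> /(off_vertexP Kv) v0; apply/(nbhs_orbit_pt _ (minitwistor_action Q)) => //.
have dv : differentiable (fun w : @minitwistor_vect R n => w.1.1) v by diff.
by apply: filterS (nbhs_neq0_differentiable dv v0) => w w0 Kw; apply/off_vertexP.
Qed.

Lemma resol_off_vertex v : KS v -> off_vertex (resol (ptS v)) <-> v.2 != 0.
Proof.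
move=> Kv; rewrite resolE //; apply: (iff_trans (off_vertexP (resol_vect_cone Kv))).
move: v Kv => [[[[z0 z1] x] y] t] [z _ _] /=; split.
  apply: contraNneq => ->; apply/eqP/rowP => i; by rewrite !mxE !mul0r.
move=> t0; apply/eqP => /veronese_eq0[/eqP|[h h']]; first exact/negP.
by apply: z; split => //; exact: infty_form_eq0 h h'.
Qed.

Lemma resol_inj x x' : off_vertex (resol x) -> resol x = resol x' -> x = x'.
Proof.
have [v Kv ->] := ale_pt_surj x; have [w Kw ->] := ale_pt_surj x'.
move=> /(resol_off_vertex Kv) v0; rewrite !resolE //.
move=> /minitwistor_ptP-/(_ (resol_vect_cone Kv) (resol_vect_cone Kw)) E.
by apply/ale_ptP => //; exact: resol_vect_inj E.
Qed.

(** The two local formulas for the inverse have different domains; choosing a preimage gives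
    one function that agrees with both. *)
Definition unresol (y : minitwistor Q) : ALE_surface a :=
  xget (ptS (1, 0, 1, 0, 0)) [set x | resol x = y].

(** Off the vertices the inverse of [resol] is given by [unresol_vect] once the position
    on the rational normal curve is read off from nonvanishing coordinates. *)
Lemma unresol_section v (t u0 u1 : @minitwistor_vect R n -> C^o) :
  KT v -> t v != 0 ->
  (forall w, t w != 0 -> [/\ differentiable t w, differentiable u0 w & differentiable u1 w]) ->
  (forall w, t w != 0 -> ~ (u0 w = 0 /\ u1 w = 0)) ->
  (forall w, KT w -> t w != 0 -> w.1.1 = veronese (t w) (u0 w) (u1 w)) ->
  holomorphic_at unresol (ptT v) /\ resol (unresol (ptT v)) = ptT v.
Proof.
move=> Kv tv d nz X.
pose G (w : @minitwistor_vect R n) := unresol_vect (t w) (u0 w) (u1 w) w.1.2 w.2.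
have GP w : KT w -> t w != 0 -> [/\ KS (G w), resol (ptS (G w)) = ptT w
    & unresol (ptT w) = ptS (G w)].
  move=> Kw tw; have wE : w = (veronese (t w) (u0 w) (u1 w), w.1.2, w.2).
    by rewrite -X // -!surjective_pairing.
  have KG : KS (G w).
    by apply: unresol_vect_cone => //; [exact: nz|rewrite -wE].
  have rG : resol (ptS (G w)) = ptT w by rewrite resolE // resol_unresol_vect -wE.
  split => //; apply/esym/resol_inj; first exact/(resol_off_vertex KG).
  rewrite rG; apply/esym.
  by apply: (@xgetPex _ _ [set x | resol x = ptT w]); exists (ptS (G w)).
have tn : \forall w \near v, t w != 0.
  by have [dt _ _] := d v tv; exact: nbhs_neq0_differentiable.
split; last by have [_ rG ->] := GP v Kv tv.
apply: (orbit_map_holomorphic_at (minitwistor_action Q) (bundle_action a)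
  (k2 := bundle_origin a) (G := G) Kv).
  by apply: filterS tn => w tw Kw; have [] := GP w Kw tw.
apply: filterS tn => w tw; have [dt du0 du1] := d w tw.
rewrite /G /unresol_vect /fibX /fibX'; diff.
Qed.

Lemma unresol_holomorphic y : off_vertex y ->
  holomorphic_at unresol y /\ resol (unresol y) = y.
Proof.
have [v Kv ->] := minitwistor_pt_surj y => /(off_vertexP Kv) v0.
have [X0|X0] := eqVneq (v.1.1 0 ord0) 0; last first.
  apply: (unresol_section (t := fun w => w.1.1 0 ord0) (u0 := fun=> 1)
    (u1 := fun w => w.1.1 0 (lift ord0 ord0) / w.1.1 0 ord0)) => //.
  - by move=> w w0; split; diff.
  - by move=> w w0 [/eqP]; rewrite oner_eq0.
  - move=> [[X W] Y] [_ [c [s [t XE]]] _] /=; rewrite !XE /= expr0 mulr1 subn0 => cs0.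
    apply/rowP => i; rewrite mxE XE expr1n mulr1.
    have s0 : s != 0.
      by apply/eqP => s0; move: cs0; rewrite s0 expr0n mulr0 eqxx.
    have c0 : c != 0 by apply/eqP => c0; move: cs0; rewrite c0 mul0r eqxx.
    have -> : c * s ^+ (n.+1 - bump 0 0) * t ^+ bump 0 0 / (c * s ^+ n.+1) = t / s.
      have -> : bump 0 0 = 1%N by [].
      by rewrite subSS subn0 expr1 exprS; field; rewrite ?expf_neq0 ?s0 ?c0.
    rewrite expr_div_n -[in s ^+ n.+1](@subnK i n.+1) ?exprD; last by rewrite -ltnS.
    by field; rewrite expf_neq0.
have Xm : v.1.1 0 ord_max != 0.
  move: v Kv v0 X0 => [[X W] Y] [_ [c [s [t XE]]] _] /=.
  rewrite !XE /= expr0 mulr1 subn0 subnn expr0 mulr1 => v0 cs0.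
  have c0 : c != 0.
    apply: contraNneq v0 => c0; apply/eqP/rowP => i; rewrite XE mxE c0 !mul0r //.
  have s0 : s = 0.
    by move/eqP: cs0; rewrite mulf_eq0 (negPf c0) expf_eq0 /= => /eqP.
  rewrite mulf_neq0 // expf_neq0 //; apply: contraNneq v0 => t0.
  apply/eqP/rowP => i; rewrite XE mxE s0 t0 !expr0n.
  by have [->|_] := eqVneq (i : nat) 0%N; rewrite ?subn0 ?mulr0 ?mul0r.
apply: (unresol_section (t := fun w => w.1.1 0 ord_max) (u1 := fun=> 1)
    (u0 := fun w => w.1.1 0 (inord n) / w.1.1 0 ord_max)) => //.
- by move=> w w0; split; diff.
- by move=> w w0 [_ /eqP]; rewrite oner_eq0.
- move=> [[X W] Y] [_ [c [s [t XE]]] _] /=; rewrite !XE /= subnn expr0 mulr1 => cs0.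
  apply/rowP => i; rewrite mxE XE expr1n mulr1 inordK //.
  have s0 : t != 0.
    by apply/eqP => s0; move: cs0; rewrite s0 expr0n mulr0 eqxx.
  have c0 : c != 0 by apply/eqP => c0; move: cs0; rewrite c0 mul0r eqxx.
  have -> : c * s ^+ (n.+1 - n) * t ^+ n / (c * t ^+ n.+1) = s / t.
    by rewrite subSnn expr1 exprS; field; rewrite ?expf_neq0 ?s0 ?c0.
  rewrite expr_div_n -[in t ^+ n.+1](@subnKC i n.+1) ?exprD; last by rewrite -ltnS.
  by field; rewrite expf_neq0.
Qed.

Lemma resol_biholomorphic :
  biholomorphic_on (resol @^-1` off_vertex) off_vertex resol.
Proof.
exists unresol; split.
- move=> x xv; split => //; apply: resol_inj; have [_ E] := unresol_holomorphic xv.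
    by rewrite E.
  exact: E.
- by move=> y yv; have [_ E] := unresol_holomorphic yv; rewrite /= E.
- by move=> x _; exact: resol_holomorphic.
- by move=> y /unresol_holomorphic[].
Qed.

End Comparison.

(** * Differentials along curves *)

Section Tangents.
Context {R : realType}.
Local Notation C := (Cplx R).
Implicit Types V W : normedModType C.

Lemma le_half_eq0 (F : numFieldType) (x : F) : 0 <= x -> x <= 2^-1 * x -> x = 0.
Proof.
move=> x0 xh; apply: le_anti; rewrite x0 andbT.
have : x <= x * 2^-1 by rewrite mulrC.
by rewrite ler_pdivlMr ?ltr0n // mulr_natr mulr2n gerDl.
Qed.

Lemma diff_curve V (h : V -> C^o) (c : C^o -> V) (nu : C) :
  differentiable c 0 -> differentiable h (c 0) ->
  (\forall s \near (0 : C^o), h (c s) = s * nu) -> 'd h (c 0) ('d c 0 1) = nu.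
Proof.
move=> dc dh hc.
have lin : is_diff (0 : C^o) (fun s : C^o => s *: (nu : C^o)) (fun s : C^o => s *: (nu : C^o)).
  exact: is_diff_scalel.
have d : differentiable (h \o c) 0 by exact: differentiable_comp.
have E := near_diff hc d.
have := diff_comp dc dh => /(congr1 (fun f : C^o -> C^o => f 1)) /= <-.
rewrite -E.
have := @diff_val _ _ _ _ _ _ _ lin => /(congr1 (fun f : C^o -> C^o => f 1)) /=.
by rewrite scale1r.
Qed.

(** When the differentials at [v0] determine every tangent vector, a left inverse of the
    linear part turns the functions into coordinates up to o(v - v0), so they take their
    values at [v0] at no other point nearby. *)
Lemma isolated_level (k r : nat) (h : 'I_r -> 'rV[C]_k -> C^o) v0 :
  (forall i, differentiable (h i) v0) ->
  row_free (\matrix_(j < k, i < r) ('d (h i) v0 (delta_mx 0 j) : C)) ->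
  \forall v \near v0, (forall i, h i v = h i v0) -> v = v0.
Proof.
set D := \matrix_(j, i) _ => dh Dfree.
pose B := pinvmx D.
have DB : D *m B = 1%:M by rewrite mulmxVp.
pose H (j : 'I_k) (v : 'rV[C]_k) : C^o := \sum_i B i j *: h i v.
have dH j : is_diff v0 (H j) (fun w => \sum_i B i j *: 'd (h i) v0 w).
  apply: is_diff_sumf => i; apply: is_diffZ.
  exact: differentiableP.
have HE j w : 'd (H j) v0 w = w 0 j.
  have := @diff_val _ _ _ _ _ _ _ (dH j) => /(congr1 (fun f : 'rV[C]_k -> C^o => f w)) ->.
  have -> : w 0 j = (w *m D *m B) 0 j by rewrite -mulmxA DB mulmx1.
  rewrite mxE; apply: eq_bigr => i _; rewrite [RHS]mulrC; congr (_ * _).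
  rewrite {1}[w]row_sum_delta linear_sum mxE; apply: eq_bigr => q _.
  by rewrite linearZ mxE.
have small : nbhs (v0 - v0) [set w : 'rV[C]_k | forall j,
    `|H j (w + v0) - H j v0 - 'd (H j) v0 w| <= 2^-1 * `|w|].
  rewrite subrr; pose S j := [set w : 'rV[C]_k |
    `|H j (w + v0) - H j v0 - 'd (H j) v0 w| <= 2^-1 * `|w|].
  suff : forall j, nbhs (0 : 'rV[C]_k) (S j) by move=> /filter_forall; exact.
  have half0 : 0 < 2^-1 :> C by rewrite invr_gt0 ltr0n.
  move=> j; have [dHj _] := dH j; exact: (differentiable_eps dHj half0).
have dsub : differentiable (fun v : 'rV[C]_k => v - v0) v0 by diff.
have := nbhs_preimage_differentiable dsub small.
apply: filterS => v Hv hv; apply/eqP; rewrite -subr_eq0 -normr_eq0.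
apply/negPn/negP => vv0; have [[i j] /=] := mx_norm_neq0 vv0.
rewrite (ord1 i) => E; have {}E : `|v - v0| = `|(v - v0) 0 j| := E.
have := Hv j; rewrite subrK HE.
have -> : H j v = H j v0 by apply: eq_bigr => q _; rewrite hv.
rewrite subrr sub0r normrN -E => /(le_half_eq0 (normr_ge0 _)) v0E.
by rewrite v0E eqxx in vv0.
Qed.

End Tangents.

(** * Independence of Veronese vectors *)

Section Independence.
Context {F : fieldType}.

Lemma row_free_ker (r q : nat) (A : 'M[F]_(r, q)) :
  (forall u : 'rV_r, u *m A = 0 -> u = 0) -> row_free A.
Proof.
move=> kA; rewrite -kermx_eq0; apply/eqP/row_matrixP => i.
by rewrite row0; apply: kA; rewrite -row_mul mulmx_ker row0.
Qed.

Lemma rank_ge_independent (r q k : nat) (D : 'M[F]_(q, k)) (T : 'I_r -> 'rV_q)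
    (nu : 'I_r -> 'rV_k) :
  (forall i, T i *m D = nu i) ->
  (forall c : 'I_r -> F, \sum_i c i *: nu i = 0 -> forall i, c i = 0) ->
  (r <= \rank D)%N.
Proof.
move=> TD free; pose N := \matrix_i nu i.
have NE : N = (\matrix_i T i) *m D.
  by apply/row_matrixP => i; rewrite row_mul !rowK TD.
have <- : \rank N = r.
  apply/eqP; apply: row_free_ker => u uN; apply/rowP => i; rewrite mxE.
  apply: (free (u 0)); move: uN; rewrite mulmx_sum_row.
  by under eq_bigr do rewrite rowK.
by rewrite NE mxrankM_maxr.
Qed.

Lemma vandermonde_free (r : nat) (c x : 'I_r -> F) : injective x ->
  (forall i, (i < r)%N -> \sum_k c k * x k ^+ i = 0) -> forall k, c k = 0.
Proof.
move=> injx E k; pose V := Vandermonde r (\row_k x k).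
have uV : V \in unitmx.
  rewrite unitmxE unitfE det_Vandermonde; apply/prodf_neq0 => i _.
  apply/prodf_neq0 => j ij; rewrite !mxE subr_eq0; apply: contraTneq ij => /injx ->.
  by rewrite ltnn.
have V0 : V *m (\col_k c k) = 0.
  apply/colP => i; rewrite !mxE -[RHS](E i (ltn_ord i)); apply: eq_bigr => j _.
  by rewrite !mxE mulrC.
by have := congr1 (fun M => invmx V *m M) V0; rewrite mulKmx // mulmx0 => /colP/(_ k); rewrite !mxE.
Qed.

End Independence.

Section VeroneseIndependence.
Context {R : realType}.
Local Notation C := (Cplx R).
Variable n : nat.
Local Notation veronese := (@veronese R n).

(** Eliminating [d] between consecutive coordinates leaves c u0^n (u0 v1 - u1 v0) at one end of
    the vector and c u1^n (u0 v1 - u1 v0) at the other. *)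
Lemma veronese_free2_aux (c d u0 u1 v0 v1 : C) : u0 * v1 != u1 * v0 ->
  c *: veronese 1 u0 u1 + d *: veronese 1 v0 v1 = 0 -> c = 0.
Proof.
move=> uv /rowP E; apply/eqP/negPn/negP => c0.
have uv0 : u0 * v1 - u1 * v0 != 0 by rewrite subr_eq0.
have E0 := E ord0; have E1 := E (lift ord0 ord0).
have En := E (inord n); have Em := E ord_max.
rewrite !mxE /= !mul1r in E0 E1 En Em.
rewrite inordK // !subSnn in En.
rewrite !subnn !expr0 !mul1r in Em.
rewrite subn0 !mulr1 in E0.
have b1 : bump 0 0 = 1%N by [].
rewrite b1 subSS subn0 !expr1 in E1.
rewrite !expr1 in En.
have u00 : u0 ^+ n = 0.
  apply/eqP; have : c * u0 ^+ n * (u0 * v1 - u1 * v0) == 0.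
    apply/eqP; transitivity (v1 * (c * u0 ^+ n.+1 + d * v0 ^+ n.+1) -
      v0 * (c * (u0 ^+ n * u1) + d * (v0 ^+ n * v1))); last by rewrite E0 E1; ring.
    by rewrite !exprS; ring.
  by rewrite !mulf_eq0 (negPf c0) (negPf uv0) orbF.
have u10 : u1 ^+ n = 0.
  apply/eqP; have : c * u1 ^+ n * (u0 * v1 - u1 * v0) == 0.
    apply/eqP; transitivity (v1 * (c * (u0 * u1 ^+ n) + d * (v0 * v1 ^+ n)) -
      v0 * (c * u1 ^+ n.+1 + d * v1 ^+ n.+1)); last by rewrite En Em; ring.
    by rewrite !exprS; ring.
  by rewrite !mulf_eq0 (negPf c0) (negPf uv0) orbF.
move/eqP: u00; move/eqP: u10; rewrite !expf_eq0 => /andP[_ /eqP u10] /andP[_ /eqP u00].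
by move: uv; rewrite u00 u10 !mul0r eqxx.
Qed.

Lemma veronese_free2 (u0 u1 v0 v1 : C) (c : 'I_2 -> C) : u0 * v1 != u1 * v0 ->
  \sum_k c k *: (if k == 0 then veronese 1 u0 u1 else veronese 1 v0 v1) = 0 ->
  forall k, c k = 0.
Proof.
move=> uv; rewrite big_ord_recl big_ord1 /= => E.
have c0 := veronese_free2_aux uv E.
have vu : v0 * u1 != v1 * u0 by rewrite eq_sym mulrC (mulrC v0).
have c1 := veronese_free2_aux vu (etrans (addrC _ _) E).
by case=> -[|[|//]] ik; [rewrite -c0|rewrite -c1]; congr c; apply: val_inj.
Qed.

Lemma veronese_free3 (u0 u1 : 'I_3 -> C) (c : 'I_3 -> C) : (0 < n)%N ->
  (forall k, u0 k != 0) -> injective (fun k => u1 k / u0 k) ->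
  \sum_k c k *: veronese 1 (u0 k) (u1 k) = 0 -> forall k, c k = 0.
Proof.
move=> n0 nz inj E k.
have : c k * u0 k ^+ n.+1 = 0.
  apply: (vandermonde_free (c := fun k => c k * u0 k ^+ n.+1) inj) => i i3.
  move/rowP: E => /(_ (inord i)).
  have il : (i < n.+2)%N by apply: leq_trans i3 _.
  rewrite summxE [RHS]mxE => E'; rewrite -[RHS]E'.
  apply: eq_bigr => j _; rewrite !mxE inordK // mul1r.
  rewrite -{1}(@subnK i n.+1) // exprD expr_div_n.
  by field; rewrite expf_neq0.
by move=> /eqP; rewrite mulf_eq0 expf_eq0 (negPf (nz k)) andbF orbF => /eqP.
Qed.

End VeroneseIndependence.

(** * Points over a vertex cannot be identified in a smooth point *)

Section Contraction.
Context {R : realType}.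
Local Notation C := (Cplx R).
Variables (n : nat) (a : 'I_n.+1.*2 -> R) (Q : 'M[R]_n.+2) (m rho : R).
Local Notation P z0 z1 := (\prod_(i < n.+1.*2) (z1 - ofReal (a i) * z0)).
Local Notation KS := (bundle_cone a).
Local Notation KT := (minitwistor_cone Q).
Local Notation eS := (bundle_rel (R := R) n.+1).
Local Notation ptS := (ale_pt a).
Local Notation ptT := (minitwistor_pt Q).
Local Notation eps := ((-1) ^+ n.+1 : C).
Local Notation resol := (@resol R n a Q m rho).
Local Notation rvec := (@resol_vect R n m rho).
Local Notation infty_form := (infty_form m).
Hypothesis rho0 : rho != 0.
Hypothesis quad_formE : forall z0 z1 t : C,
  quad_form Q (veronese n t (infty_form z0 z1) z0) = eps * ofReal rho ^+ 2 * (t ^+ 2 * P z0 z1).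

(** The curves contracted by [resol] are y = t = 0, on which x = 1 can be assumed, and
    x = t = 0, on which y = 1 can be assumed. As [s] varies, [transversal] leaves the former
    (for [bx] true) or the latter at the point over [z0 : z1], staying on the surface. *)
Definition transversal (bx : bool) (z0 z1 s : C) : @bundle_vect R :=
  (z0, z1, if bx then 1 else s ^+ 2 * P z0 z1, if bx then s ^+ 2 * P z0 z1 else 1, s).

Lemma transversal_cone bx z0 z1 s : ~ (z0 = 0 /\ z1 = 0) -> KS (transversal bx z0 z1 s).
Proof.
move=> z; rewrite /transversal; case: bx; split; rewrite ?mul1r ?mulr1 //.
  by move=> [/eqP]; rewrite oner_eq0.
by move=> [_ /eqP]; rewrite oner_eq0.
Qed.

Let tuple_eq (z0 z1 x y t z0' z1' x' y' t' : C) :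
  z0 = z0' -> z1 = z1' -> x = x' -> y = y' -> t = t' ->
  (z0, z1, x, y, t) = (z0', z1', x', y', t') :> @bundle_vect R.
Proof. by move=> -> -> -> -> ->. Qed.

Lemma transversal0 bx z0 z1 :
  transversal bx z0 z1 0 = (z0, z1, if bx then 1 else 0, if bx then 0 else 1, 0).
Proof.
have E : 0 ^+ 2 * P z0 z1 = 0 by rewrite expr0n mul0r.
by rewrite /transversal E.
Qed.

Lemma transversal_scale bx k z0 z1 : k != 0 ->
  eS (transversal bx z0 z1 0) (transversal bx (k * z0) (k * z1) 0).
Proof.
move=> k0; exists k, (k ^- n.+1); rewrite invr_eq0 expf_neq0 //; split=> //.
rewrite !transversal0; apply: tuple_eq => //; rewrite ?mulr0 //;
  by rewrite divff ?expf_neq0 // mul1r.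
Qed.

Lemma transversal_surj v : KS v -> v.2 = 0 -> exists bx z0 z1,
  ~ (z0 = 0 /\ z1 = 0) /\ ptS v = ptS (transversal bx z0 z1 0).
Proof.
move: v => [[[[z0 z1] x] y] t] Kv t0; have {}t0 : t = 0 := t0.
have [z xyt xy] := Kv.
have [x0|x0] := eqVneq x 0.
  have y0 : y != 0 by apply/eqP => y0; apply: xyt.
  exists false, z0, z1; split => //; apply/ale_ptP => //.
    exact: transversal_cone.
  exists 1, y^-1; rewrite invr_eq0 oner_eq0; split => //.
  rewrite transversal0 x0 t0; apply: tuple_eq; rewrite ?mulr0 ?mul1r //.
  by rewrite expr1n mul1r mulVf.
have y0 : y = 0.
  by move: xy; rewrite t0 expr0n mul0r => /eqP; rewrite mulf_eq0 (negPf x0) => /eqP.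
exists true, z0, z1; split => //; apply/ale_ptP => //.
  exact: transversal_cone.
exists 1, x^-1; rewrite invr_eq0 oner_eq0; split => //.
rewrite transversal0 y0 t0; apply: tuple_eq; rewrite ?mulr0 ?mul1r //.
by rewrite expr1n mul1r mulVf.
Qed.

Lemma differentiable_transversal bx (f0 f1 f2 : C^o -> C^o) s :
  differentiable f0 s -> differentiable f1 s -> differentiable f2 s ->
  differentiable (fun s => transversal bx (f0 s) (f1 s) (f2 s)) s.
Proof. by move=> d0 d1 d2; rewrite /transversal; case: bx; diff. Qed.

(** Affine coordinates of the cone at the image of one of the contracted curves: the
    denominator is the fibre coordinate that does not vanish there. *)
Definition vertex_coord (bx : bool) (i : 'I_n.+2) (y : minitwistor Q) : C :=
  let v := \val (orbit_repr y) in
  v.1.1 0 i / (if bx then fibX rho v.1.2 v.2 else fibX' n rho v.1.2 v.2).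

Lemma vertex_coordE bx i v : KT v -> vertex_coord bx i (ptT v) =
  v.1.1 0 i / (if bx then fibX rho v.1.2 v.2 else fibX' n rho v.1.2 v.2).
Proof.
move=> Kv; have [c c0 E] := orbit_repr_ptP (homothetyE n) (minitwistor_origin Q) Kv.
rewrite /vertex_coord /=.
have -> : \val (orbit_repr (ptT v)) = c *: v by exact: E.
have -> : (c *: v).1.1 0 i = c * v.1.1 0 i by rewrite mxE.
have -> : (if bx then fibX rho (c *: v).1.2 (c *: v).2
           else fibX' n rho (c *: v).1.2 (c *: v).2) =
    c * (if bx then fibX rho v.1.2 v.2 else fibX' n rho v.1.2 v.2).
  have -> : (c *: v).1.2 = c * v.1.2 by [].
  have -> : (c *: v).2 = c * v.2 by [].
  by case: bx; rewrite /fibX /fibX'; ring.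
by rewrite -mulf_div divff // mul1r.
Qed.

Lemma vertex_coord_hol bx i v : KT v ->
  (if bx then fibX rho v.1.2 v.2 else fibX' n rho v.1.2 v.2) != 0 ->
  hol_at (ptT v) (vertex_coord bx i).
Proof.
move=> Kv v0.
pose lin (w : @minitwistor_vect R n) : C^o :=
  if bx then fibX rho w.1.2 w.2 else fibX' n rho w.1.2 w.2.
have dlin w : differentiable lin w.
  by rewrite /lin /fibX /fibX'; case: (bx); diff.
apply/(orbit_hol_atP _ (minitwistor_action Q)) => //.
exists (fun w : @minitwistor_vect R n => w.1.1 0 i / lin w); split.
  apply: filterS (nbhs_neq0_differentiable (dlin v) v0) => w w0; diff.
by apply: filterE => w Kw; exact: vertex_coordE.
Qed.

Lemma vertex_coord_transversal bx i z0 z1 s : ~ (z0 = 0 /\ z1 = 0) ->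
  vertex_coord bx i (resol (ptS (transversal bx z0 z1 s))) =
  s * veronese n 1 (infty_form z0 z1) z0 0 i.
Proof.
move=> z; rewrite (resolE rho0 quad_formE); last exact: transversal_cone.
rewrite vertex_coordE; last exact: (resol_vect_cone rho0 quad_formE (transversal_cone _ _ z)).
rewrite /transversal; case: bx; rewrite /resol_vect (fibXK, fibX'K) // divr1 !mxE mul1r mulrA //.
Qed.

Section Factorization.
Variables (Y : holspace R) (b : ALE_surface a -> Y) (p' : Y -> minitwistor Q).
Hypotheses (hb : holomorphic b) (hp' : holomorphic p') (pb : resol =1 p' \o b).

Lemma near_curve (gam : C^o -> @bundle_vect R) (B : set Y) s :
  (forall s, KS (gam s)) -> differentiable gam s ->
  nbhs (b (ptS (gam s))) B -> \forall s' \near s, B (b (ptS (gam s'))).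
Proof.
move=> Kg dg nB; have [cb _] := hb (ptS (gam s)).
have {}nB : nbhs (ptS (gam s)) (b @^-1` B) := cb _ nB.
have := nbhs_preimage_differentiable dg (orbit_pt_continuous (Kg s) nB).
by apply: filterS => s' nB'; exact: nB'.
Qed.

Lemma differentiable_curve (gam : C^o -> @bundle_vect R) (f : Y -> C) s :
  (forall s, KS (gam s)) -> differentiable gam s -> hol_at (b (ptS (gam s))) f ->
  differentiable (fun s' => f (b (ptS (gam s'))) : C^o) s.
Proof.
move=> Kg dg hf; have [_ /(_ f hf)] := hb (ptS (gam s)).
move=> /(orbit_hol_atP _ (bundle_action a) _ (Kg s))[F [dF fF]].
apply: (@near_differentiable _ _ _ (F \o gam)).
  have := nbhs_preimage_differentiable dg fF.
  by apply: filterS => s' E; rewrite /= -E.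
by apply: differentiable_comp => //; exact: (nbhs_singleton dF).
Qed.

Section Chart.
Variables (U : set Y) (phi : Y -> @affine_space R 2) (psi : @affine_space R 2 -> Y) (y : Y).
Hypotheses (oU : open U) (Uy : U y) (phiK : forall x, U x -> psi (phi x) = x).
Hypotheses (hphi : holomorphic_at phi y) (hpsi : holomorphic_at psi (phi y)).
Variable bx : bool.

Let h (i : 'I_n.+2) : 'rV[C]_2 -> C^o := fun v => vertex_coord bx i (p' (psi v)).
Let D := \matrix_(j < 2, i < n.+2) ('d (h i) (phi y) (delta_mx 0 j) : C).

Let lin_transversal z0 z1 s : ~ (z0 = 0 /\ z1 = 0) ->
  let w := rvec (transversal bx z0 z1 s) in
  (if bx then fibX rho w.1.2 w.2 else fibX' n rho w.1.2 w.2) = 1.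
Proof. by rewrite /transversal; case: bx => _; rewrite /= (fibXK, fibX'K). Qed.

Let dh i z0 z1 : ~ (z0 = 0 /\ z1 = 0) -> b (ptS (transversal bx z0 z1 0)) = y ->
  differentiable (h i) (phi y).
Proof.
move=> z by_.
have Kz := transversal_cone bx 0 z.
have hy : hol_at (p' y) (vertex_coord bx i).
  have -> : p' y = ptT (rvec (transversal bx z0 z1 0)).
    rewrite -by_; exact: etrans (esym (pb _)) (resolE rho0 quad_formE Kz).
  apply: vertex_coord_hol; first exact: (resol_vect_cone rho0 quad_formE Kz).
  by rewrite lin_transversal // oner_eq0.
have {}hy := (hp' y).2 _ hy.
rewrite -(phiK Uy) in hy; exact: (nbhs_singleton (hpsi.2 _ hy)).
Qed.

(** The image of a transversal curve in the chart has a velocity vector, along which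
    the vertex coordinates grow as the Veronese vector of its base point. *)
Let tangent z0 z1 : ~ (z0 = 0 /\ z1 = 0) -> b (ptS (transversal bx z0 z1 0)) = y ->
  exists T : 'rV[C]_2, T *m D = veronese n 1 (infty_form z0 z1) z0.
Proof.
move=> z by_; pose gam (s : C^o) := transversal bx z0 z1 s.
have Kg s : KS (gam s) by exact: transversal_cone.
have dg s : differentiable gam s by apply: differentiable_transversal; diff.
pose c (s : C^o) : 'rV[C]_2 := phi (b (ptS (gam s))).
have c0 : c 0 = phi y by rewrite /c by_.
have dc : differentiable c 0.
  have -> : c = (fun s => pair_row (c s 0 0) (c s 0 1)).
    by apply/funext => s; rewrite pair_row_eta.
  have dcoord k : differentiable (fun s => c s 0 k : C^o) 0.
    apply: (@differentiable_curve gam (fun x => (phi x : 'rV[C]_2) 0 k)) => //.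
    rewrite /gam by_; apply: (hphi.2 (fun v : 'rV[C]_2 => v 0 k)).
    by apply: filterE => v; diff.
  exact: differentiable_pair_row.
have nU : \forall s \near (0 : C^o), U (b (ptS (gam s))).
  by apply: near_curve => //; rewrite /gam by_; exact: open_nbhs_nbhs.
exists ('d c 0 1); apply/rowP => i.
have Ei : 'd (h i) (c 0) ('d c 0 1) = veronese n 1 (infty_form z0 z1) z0 0 i.
  apply: diff_curve => //; first by rewrite c0; exact: dh by_.
  apply: filterS nU => s Us; rewrite /h /c phiK // -/((p' \o b) _) -pb.
  exact: vertex_coord_transversal.
rewrite mxE -Ei c0.
rewrite [in RHS](row_sum_delta ('d c 0 1)) linear_sum; apply: eq_bigr => j _.
by rewrite linearZ mxE.
Qed.

(** The vertex coordinates vanish along a contracted curve, so when they isolate [y] the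
    neighbouring points of the curve are sent to [y] as well. *)
Let isolated (f0 f1 : C^o -> C^o) :
  (forall s, ~ (f0 s = 0 /\ f1 s = 0)) -> differentiable f0 0 -> differentiable f1 0 ->
  row_free D -> b (ptS (transversal bx (f0 0) (f1 0) 0)) = y ->
  \forall s \near (0 : C^o), b (ptS (transversal bx (f0 s) (f1 s) 0)) = y.
Proof.
move=> nz d0 d1 Dfree by_.
pose gam (s : C^o) := transversal bx (f0 s) (f1 s) 0.
have Kg s : KS (gam s) by exact: transversal_cone.
have dg : differentiable gam 0.
  by apply: differentiable_transversal => //; diff.
have iso := isolated_level (fun i => dh i (nz 0) by_) Dfree.
pose S : set (@affine_space R 2) :=
  [set v | (forall i, h i v = h i (phi y)) -> v = phi y].
have {}iso : nbhs y (phi @^-1` S) by apply: hphi.1; exact: iso.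
have nB : nbhs (b (ptS (gam 0))) (U `&` phi @^-1` S).
  rewrite /gam by_; exact: filterI (open_nbhs_nbhs (conj oU Uy)) iso.
have := near_curve Kg dg nB; apply: filterS => s [Us /= E].
rewrite -(phiK Us) -[RHS](phiK Uy) E // => i.
rewrite /h !phiK // -by_ -![p' (b _)]/((p' \o b) _) -!pb.
by rewrite !vertex_coord_transversal // !mul0r.
Qed.

(** Two points of a contracted curve over [y] make the differential of the vertex coordinates
    injective, hence a whole arc of the curve lies over [y]; three points of that arc give
    three independent Veronese vectors in the image of a plane. *)
Lemma contracted_fiber_proportional z0 z1 w0 w1 : (0 < n)%N ->
  ~ (z0 = 0 /\ z1 = 0) -> ~ (w0 = 0 /\ w1 = 0) ->
  b (ptS (transversal bx z0 z1 0)) = y -> b (ptS (transversal bx w0 w1 0)) = y ->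
  z0 * w1 = z1 * w0.
Proof.
move=> n0 z w bz bw; apply/eqP/negPn/negP => zw.
have uv : infty_form z0 z1 * w0 != z0 * infty_form w0 w1.
  apply: contraNneq zw => E; apply/eqP.
  have -> : z1 * w0 = ofReal m * z0 * w0 - infty_form z0 z1 * w0 by rewrite /infty_form; ring.
  by rewrite E /infty_form; ring.
have [Tz TzE] := tangent z bz; have [Tw TwE] := tangent w bw.
have Dfree : row_free D.
  rewrite /row_free eqn_leq rank_leq_row /=.
  apply: (rank_ge_independent (T := fun k : 'I_2 => if k == 0 then Tz else Tw)
    (nu := fun k : 'I_2 => if k == 0 then veronese n 1 (infty_form z0 z1) z0
                           else veronese n 1 (infty_form w0 w1) w0)).
    by move=> k; case: (k == 0).
  move=> c; exact: veronese_free2 uv.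
(* (d0, d1) is a direction, in the coordinates (u0, u1) of the base, that moves the point z and
   along which u0 does not vanish at nonzero parameters *)
pose d1 : C := if infty_form z0 z1 == 0 then 0 else 1.
pose d0 : C := if infty_form z0 z1 == 0 then 1 else 0.
pose u0 (s : C) := infty_form z0 z1 + s * d0.
pose u1 (s : C) := z0 + s * d1.
have u0N s : s != 0 -> u0 s != 0.
  move=> s0; rewrite /u0 /d0; have [E|E] := eqVneq (infty_form z0 z1) 0.
    by rewrite E add0r mulr1.
  by rewrite mulr0 addr0.
have uinj s t : s != 0 -> t != 0 -> u1 s / u0 s = u1 t / u0 t -> s = t.
  move=> s0 t0 /eqP; rewrite eqr_div ?u0N // /u0 /u1 /d0 /d1.
  have [E|E] := eqVneq (infty_form z0 z1) 0.
    have z00 : z0 != 0.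
      by apply/eqP => z00; apply: z; split => //; exact: infty_form_eq0 E z00.
    rewrite E !mulr0 !addr0 !add0r !mulr1 => /eqP/(mulfI z00) ->.
    by [].
  rewrite !mulr0 !addr0 !mulr1 => /eqP/(mulIf E)/addrI //.
pose f1 (s : C^o) : C^o := ofReal m * u1 s - u0 s.
have fN s : ~ (u1 s = 0 /\ f1 s = 0).
  rewrite /f1 => -[u10 /eqP]; rewrite u10 mulr0 sub0r oppr_eq0 => /eqP.
  move: u10; rewrite /u0 /u1 /d0 /d1; have [E|E] := eqVneq (infty_form z0 z1) 0.
    by rewrite mulr0 addr0 => u10 _; apply: z; split => //; exact: infty_form_eq0 E u10.
  by rewrite mulr0 addr0 => _ /eqP; rewrite (negPf E).
have near0 : \forall s \near (0 : C^o), b (ptS (transversal bx (u1 s) (f1 s) 0)) = y.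
  apply: (isolated (f0 := u1)) => //.
  have -> : u1 0 = z0 by rewrite /u1 mul0r addr0.
  have -> : f1 0 = z1 by rewrite /f1 /u1 /u0 !mul0r !addr0 /infty_form; ring.
  exact: bz.
have [e e0 Ee] : exists2 e : C, e != 0 &
    forall k : 'I_3, b (ptS (transversal bx (u1 (k.+1%:R * e)) (f1 (k.+1%:R * e)) 0)) = y.
  move: near0; rewrite /prop_near1 nbhs_ballP => -[r /= r0 rE].
  (* the multiples e, 2 e and 3 e must lie in the ball of radius r *)
  exists (r / 4); first by rewrite mulf_neq0 ?invr_eq0 ?gt_eqF ?ltr0n.
  move=> k; apply: rE; rewrite -ball_normE /= sub0r normrN.
  rewrite gtr0_norm ?mulr_gt0 ?invr_gt0 ?ltr0n // mulrCA gtr_pMr //.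
  by rewrite ltr_pdivrMr ?ltr0n // mul1r ltr_nat ltnS.
have se k : k.+1%:R * e != 0 by rewrite mulf_neq0 // pnatr_eq0.
suff : (3 <= \rank D)%N by rewrite leqNgt ltnS rank_leq_row.
have T3 (k : 'I_3) : {T : 'rV[C]_2 |
    T *m D = veronese n 1 (u0 (k.+1%:R * e)) (u1 (k.+1%:R * e))}.
  apply: cid; have [T TE] := tangent (fN _) (Ee k); exists T.
  by rewrite TE /f1 infty_form_inv.
apply: (rank_ge_independent (fun k : 'I_3 => projT2 (T3 k))) => c.
apply: veronese_free3 => // [k|i j E]; first exact: u0N.
apply: val_inj; apply/eqP; rewrite -eqSS -(eqr_nat C); apply/eqP/(mulIf e0).
exact: uinj E.
Qed.

End Chart.

(** Points identified by [b] have the same image under [resol]; if they differ, they lie over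
    a vertex, on the same contracted curve, and [contracted_fiber_proportional] applies. *)
Lemma no_smooth_contraction (y : Y) e1 e2 : (0 < n)%N -> @regular_locus R Y y ->
  b e1 = y -> b e2 = y -> e1 = e2.
Proof.
move=> n0 [U [V [phi [oU Uy oV [psi [phiU psiV hphi hpsi]]]]]] b1 b2.
have res : resol e1 = resol e2.
  exact: etrans (pb e1) (etrans (congr1 p' (etrans b1 (esym b2))) (esym (pb e2))).
have [off|on] := pselect (off_vertex (resol e1)).
  exact: (resol_inj rho0 quad_formE off res).
have on2 : ~ off_vertex (resol e2) by rewrite -res.
have normal x : ~ off_vertex (resol x) -> exists bx z0 z1,
    ~ (z0 = 0 /\ z1 = 0) /\ x = ptS (transversal bx z0 z1 0).
  have [v Kv ->] := ale_pt_surj x => offv; apply: transversal_surj => //.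
  apply/eqP/negPn/negP => v0; apply: offv.
  exact/(resol_off_vertex rho0 quad_formE Kv).
have [bx [z0 [z1 [z e1E]]]] := normal _ on.
have [bx' [w0 [w1 [w e2E]]]] := normal _ on2.
have [Kz Kw] := (transversal_cone bx 0 z, transversal_cone bx' 0 w).
have bxE : bx' = bx.
  move: res; rewrite e1E e2E !(resolE rho0 quad_formE) //.
  have cone v : KS v -> _ := resol_vect_cone rho0 quad_formE (v := v).
  move=> /minitwistor_ptP-/(_ (cone _ Kz) (cone _ Kw)).
  rewrite !transversal0 => -[c c0 [_ EW EY]].
  have [] := fib_scale rho0 EW EY.
  case: (bx); case: (bx') => // /eqP + /eqP;
    by rewrite ?mulr0 ?mulr1 ?oner_eq0 // eq_sym (negPf c0).
rewrite e1E bxE in e2E b1 b2 *.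
have [k k0 [w0E w1E]] : exists2 k : C, k != 0 & w0 = k * z0 /\ w1 = k * z1.
  apply: proportional2 => //.
  apply: (contracted_fiber_proportional oU Uy (fun x Ux => (phiU x Ux).2)
    (hphi y Uy) (hpsi _ (phiU y Uy).1) n0 z w b1).
  by rewrite -e2E.
rewrite e2E; apply/ale_ptP => //; first by rewrite -bxE.
by rewrite w0E w1E; exact: transversal_scale.
Qed.

End Factorization.
End Contraction.

(** * The minimal resolution *)

Lemma half_in_ball (F : numFieldType) (r : F) : 0 < r -> r / 2 != 0 /\ `|r / 2| < r.
Proof.
move=> r0; have h0 : 0 < r / 2 by rewrite divr_gt0 ?ltr0n.
split; first by rewrite gt_eqF.
by rewrite gtr0_norm // ltr_pdivrMr ?ltr0n // ltr_pMr // ltr1n.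
Qed.

Section Resolution.
Context {R : realType}.
Local Notation C := (Cplx R).
Variables (n : nat) (a : 'I_n.+1.*2 -> R) (Q : 'M[R]_n.+2) (m rho : R).
Local Notation P z0 z1 := (\prod_(i < n.+1.*2) (z1 - ofReal (a i) * z0)).
Local Notation KS := (bundle_cone a).
Local Notation ptS := (ale_pt a).
Local Notation ptT := (minitwistor_pt Q).
Local Notation eps := ((-1) ^+ n.+1 : C).
Local Notation resol := (@resol R n a Q m rho).
Local Notation infty_form := (infty_form m).
Hypothesis rho0 : rho != 0.
Hypothesis quad_formE : forall z0 z1 t : C,
  quad_form Q (veronese n t (infty_form z0 z1) z0) = eps * ofReal rho ^+ 2 * (t ^+ 2 * P z0 z1).

Lemma fibW_conj (x y : C) :
  fibW n rho (eps * y^*) (eps * x^*) = (fibW n rho x y)^*.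
Proof.
rewrite /fibW !rmorphM /= fmorphV rmorphD /= rmorph_nat conj_ofReal.
rewrite (rmorphM _ eps) /= rmorphXn /= rmorphN1 mulrA -expr2 sqrr_sign.
by congr (_ * _ * _); rewrite [LHS]addrC; congr (_ + _); exact: mul1r.
Qed.

Lemma fibY_conj (x y : C) :
  fibY n rho (eps * y^*) (eps * x^*) = (fibY n rho x y)^*.
Proof.
rewrite /fibY !rmorphM /= fmorphV /= !rmorphM /= rmorph_nat conjCi rmorphB /= conj_ofReal.
rewrite (rmorphM _ eps) /= rmorphXn /= rmorphN1 mulrA -expr2 sqrr_sign.
have -> : 1 * x^* = x^* by exact: mul1r.
rewrite mulrN invrN mulrN -mulNr; congr (_ * _).
by rewrite -mulrN opprB.
Qed.

(** [tau] exchanges x and y up to the sign [eps] and conjugates the base, as [m] is real. *)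
Lemma resol_tau x : resol (tau a x) = sigma Q (resol x).
Proof.
have [v Kv ->] := ale_pt_surj x.
rewrite tau_ptE // (resolE rho0 quad_formE (tau_cone Kv)) (resolE rho0 quad_formE Kv).
have KTv := resol_vect_cone rho0 quad_formE Kv.
apply/esym; apply: sigmaE.
rewrite !val_orbit_pt //; last first.
  exact: (resol_vect_cone rho0 quad_formE (tau_cone Kv)).
move: v {Kv KTv} => [[[[z0 z1] x'] y] t].
rewrite /tau_vect /resol_vect /sigma_vect fibW_conj fibY_conj.
have -> // : veronese n t^* (infty_form z0^* z1^*) z0^* =
    map_mx Num.conj (veronese n t (infty_form z0 z1) z0).
apply/rowP => i; rewrite !mxE !rmorphM /= !rmorphXn /= /infty_form rmorphB /= rmorphM /=.
by rewrite conj_ofReal.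
Qed.

Hypotheses (inja : injective a) (n0 : (0 < n)%N).

Let resol_holo := resol_holomorphic rho0 quad_formE.

(** A vertex is singular since [resol] sends a whole curve to it, which
    [no_smooth_contraction] forbids at a smooth point of the target. *)
Lemma off_vertex_regular : @regular_locus R (minitwistor Q) = @off_vertex R n Q.
Proof.
apply/seteqP; split => y; last first.
  move=> yoff; have [_ E] := unresol_holomorphic rho0 quad_formE yoff.
  rewrite -E; apply: (regular_locus_biholomorphic (A := resol @^-1` @off_vertex R n Q)
    (B := @off_vertex R n Q)); last exact: (ale_complex_surface inja).2.
  - rewrite openE => x xoff; apply: (resol_holo x).1.
    exact: open_nbhs_nbhs (conj (@open_off_vertex _ _ _) xoff).
  - exact: open_off_vertex.
  - exact: (resol_biholomorphic rho0 quad_formE).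
  - by rewrite /= E.
have [v Kv ->] := minitwistor_pt_surj y => reg; apply/(off_vertexP Kv)/negP => v0.
move: v Kv v0 reg => [[X W] Y] Kv /eqP X0; have {}X0 : X = 0 := X0.
move: Kv; rewrite X0 => Kv reg.
have xy : fibX rho W Y * fibX' n rho W Y = 0.
  rewrite fib_quad //; case: Kv => _ _ ->.
  by rewrite -(scale0r (0 : 'rV_n.+2)) quad_formZ expr0n mul0r sub0r subrr mulr0 mul0r.
pose x := fibX rho W Y; pose x' := fibX' n rho W Y.
have xN : ~ [/\ x = 0, x' = 0 & 0 = 0 :> C].
  move=> [x0 x'0 _]; case: Kv => + _ _; apply.
  have W0 : W = 0 by rewrite -(fibWK n rho0 W Y) -/x -/x' x0 x'0 /fibW mulr0 addr0 mulr0 mul0r.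
  have Y0 : Y = 0 by rewrite -(fibYK n rho0 W Y) -/x -/x' x0 x'0 /fibY mulr0 subr0 mulr0 mul0r.
  by rewrite W0 Y0.
have Kz (z0 z1 : C) : ~ (z0 = 0 /\ z1 = 0) -> KS (z0, z1, x, x', 0).
  by move=> z; split => //; rewrite xy expr0n mul0r.
have res (z0 z1 : C) : ~ (z0 = 0 /\ z1 = 0) -> resol (ptS (z0, z1, x, x', 0)) = ptT (0, W, Y).
  move=> z; rewrite (resolE rho0 quad_formE (Kz _ _ z)) /resol_vect fibWK // fibYK //.
  have -> // : veronese n 0 (infty_form z0 z1) z0 = 0.
  by apply/rowP => i; rewrite !mxE !mul0r.
have z10 : ~ (1 = 0 :> C /\ 0 = 0 :> C) by move=> [/eqP]; rewrite oner_eq0.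
have z01 : ~ (0 = 0 :> C /\ 1 = 0 :> C) by move=> [_ /eqP]; rewrite oner_eq0.
have := no_smooth_contraction rho0 quad_formE resol_holo (@holomorphic_id R _)
  (fun x => erefl) n0 reg (res _ _ z10) (res _ _ z01).
move=> /ale_ptP-/(_ (Kz _ _ z10) (Kz _ _ z01)) [c [d [c0 d0 [/esym/eqP]]]].
by rewrite mulr1 (negPf c0).
Qed.

(** A point of a contracted curve is the limit of the points of a transversal curve. *)
Lemma dense_off_vertex : dense (resol @^-1` @off_vertex R n Q).
Proof.
move=> O [x Ox] oO; have [offx|on] := pselect (off_vertex (resol x)); first by exists x.
have [v Kv xE] := ale_pt_surj x.
have v0 : v.2 = 0.
  apply/eqP/negPn/negP => v0; apply: on; rewrite xE.
  exact/(resol_off_vertex rho0 quad_formE Kv).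
have [bx [z0 [z1 [z vE]]]] := transversal_surj Kv v0.
pose gam (s : C^o) := transversal a bx z0 z1 s.
have Kg s : KS (gam s) by exact: transversal_cone.
have dg : differentiable gam 0 by apply: differentiable_transversal; diff.
have nO : nbhs (ptS (gam 0)) O.
  by apply: open_nbhs_nbhs; split => //; rewrite /gam -vE -xE.
have near0 : \forall s \near (0 : C^o), O (ptS (gam s)).
  have := nbhs_preimage_differentiable dg (orbit_pt_continuous (Kg 0) nO).
  by apply: filterS => s; apply; exact: Kg.
have [r [r0 rO]] : exists r : C, r != 0 /\ O (ptS (gam r)).
  move: near0; rewrite /prop_near1 nbhs_ballP => -[r /= r0 rO].
  have [rn rlt] := half_in_ball r0.
  by exists (r / 2); split=> //; apply: rO; rewrite -ball_normE /= sub0r normrN.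
exists (ptS (gam r)); split; first exact: rO.
have offs : (gam r).2 != 0 := r0.
exact: ((resol_off_vertex rho0 quad_formE (Kg _)).2 offs).
Qed.

Lemma resol_proper (B : set (minitwistor Q)) : compact B -> compact (resol @^-1` B).
Proof.
move=> cB; apply: (subclosed_compact _ (@ale_compact R n.+1 a)) => //.
apply: (@preimage_closed _ _ resol).
  by move=> x _; exact: (resol_holo x).1.
exact: compact_closed (@minitwistor_hausdorff _ _ _) cB.
Qed.

Lemma resol_minimal_resolution : minimal_resolution resol.
Proof.
split.
  split.
  - exact: ale_complex_surface.
  - exact: resol_holo.
  - exact: resol_proper.
  - by rewrite off_vertex_regular; exact: dense_off_vertex.
  - by rewrite off_vertex_regular; exact: (resol_biholomorphic rho0 quad_formE).
move=> E [X' [p' [b [x' [[[_ reg'] hp' _ _ _] hb pb EE [_ [e1 [e2 [Ee1 Ee2 e12]]]]]]]]].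
rewrite EE in Ee1 Ee2; apply: e12.
exact: (no_smooth_contraction rho0 quad_formE hb hp' pb n0 (reg' x') Ee1 Ee2).
Qed.

End Resolution.

(** * The hyperelliptic curve *)

Section HyperellipticCurve.
Context {R : realType}.
Local Notation C := (Cplx R).

Lemma prod_pairs (F : nat -> {poly R}) r :
  \prod_(i < r) (F i.*2 * F i.*2.+1) = \prod_(k < r.*2) F k.
Proof.
elim: r => [|r ih]; first by rewrite !big_ord0.
by rewrite big_ord_recr ih doubleS !big_ord_recr /= mulrA.
Qed.

(** Any even number of distinct reals, once sorted, gives the branch points of a
    real hyperelliptic curve of the required form. *)
Lemma hyperelliptic_branch (g : nat) (b : 'I_g.+1.*2 -> R) : injective b ->
  exists lam lam' : 'I_g.+1 -> R,
    [/\ forall i, lam i < lam' i,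
        forall i j : 'I_g.+1, (i < j)%N -> lam' i < lam j
      & hyperelliptic_poly lam lam' = - \prod_i ('X - (b i)%:P)].
Proof.
move=> injb; pose s := sort <=%O (codom b).
have sz : size s = g.+1.*2 by rewrite size_sort size_codom card_ord.
have sS : sorted <%O s by rewrite sort_lt_sorted; exact/injectiveP.
have mono i j : (i < j)%N -> (j < g.+1.*2)%N -> s`_i < s`_j.
  move=> ij jg; rewrite (lt_sorted_ltn_nth 0 sS) // inE sz //.
  exact: ltn_trans jg.
exists (fun i => s`_i.*2), (fun i => s`_i.*2.+1); split.
- by move=> i; apply: mono => //; rewrite -doubleS leq_double ltnS -ltnS.
- move=> i j ij; apply: mono; first by rewrite -doubleS leq_double.
  by rewrite ltn_double.
- rewrite /hyperelliptic_poly; congr (- _).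
  rewrite (prod_pairs (fun k => 'X - (s`_k)%:P)).
  transitivity (\prod_(x <- s) ('X - x%:P)).
    by rewrite [RHS](big_nth 0) sz big_mkord.
  rewrite (perm_big (codom b)) /=; last by rewrite perm_sort.
  by rewrite /codom /image_mem big_map big_enum.
Qed.

Lemma horner_branch (N : nat) (b : 'I_N -> R) (z : C) :
  (map_poly (@ofReal R) (- \prod_i ('X - (b i)%:P))).[z] = - \prod_i (z - ofReal (b i)).
Proof.
rewrite -[map_poly _ _]/(map_poly (real_complex R) _) rmorphN rmorph_prod hornerN horner_prod.
by congr (- _); apply: eq_bigr => i _; rewrite /= map_polyXsubC hornerXsubC.
Qed.

(** A polynomial of degree at most 2 (g + 1) is the restriction of a quadratic form to
    the rational normal curve: every monomial is a product of two coordinates. *)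
Lemma quadratic_representation (g : nat) (f : {poly R}) : (size f <= g.+1.*2.+1)%N ->
  exists Q : 'M[R]_g.+2, (forall z : C,
    quad_form Q (\row_i z ^+ i) = (map_poly (@ofReal R) f).[z]) /\
    Q ord_max ord_max = f`_(g.+1.*2).
Proof.
move=> szf.
pose Q : 'M[R]_g.+2 := \matrix_(i, j)
  if i == ord0 then f`_j else if j == ord_max then f`_(i + g.+1) else 0.
exists Q; split; last first.
  by rewrite mxE /= eqxx addnn.
move=> z; rewrite -[map_poly _ _]/(map_poly (real_complex R) _).
have sz : (size (map_poly (real_complex R) f) <= g.+2 + g.+1)%N.
  by rewrite size_map_poly; apply: leq_trans szf _; rewrite -addnn addSn.
rewrite (horner_coef_wide _ sz) big_split_ord /quad_form big_ord_recl /=.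
congr (_ + _).
  by apply: eq_bigr => j _; rewrite !mxE /= mulr1 coef_map.
apply: eq_bigr => i _; rewrite (bigD1 ord_max) //= big1 ?addr0; last first.
  by move=> j jm; rewrite !mxE /= (negPf jm) mul0r mul0r.
rewrite !mxE /= eqxx coef_map -mulrA -exprD /bump /= add1n.
by rewrite !addSn addnS (addnC g).
Qed.

End HyperellipticCurve.

Section Moebius.
Context {R : realType}.
Local Notation C := (Cplx R).
Variables (n : nat) (a : 'I_n.+1.*2 -> R).

(** The sign of the product decides which real structure the surface carries: for odd
    n + 1 the point m sent to infinity can be taken below all the [a i], for even n + 1
    between the first two of them. *)
Lemma exists_moving_point : (forall i j : 'I_n.+1.*2, (i < j)%N -> a i < a j) ->
  exists m, 0 < - (-1) ^+ n.+1 * \prod_i (m - a i).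
Proof.
move=> incr; pose i0 : 'I_n.+1.*2 := Ordinal (ltn0Sn n.*2.+1 : 0 < n.+1.*2)%N.
pose i1 : 'I_n.+1.*2 := Ordinal (isT : 1 < n.+1.*2)%N.
have [od|ev] := boolP (odd n.+1); rewrite -signr_odd.
  exists (a i0 - 1); rewrite od expr1 opprK mul1r.
  under eq_bigr do rewrite -opprB.
  rewrite prodrN card_ord -signr_odd odd_double expr0 mul1r.
  apply: prodr_gt0 => i _; rewrite opprB addrCA ltr_wpDr ?ltr01 // subr_ge0.
  have [->//|ii0] := eqVneq i i0.
  by apply/ltW/incr; rewrite lt0n; apply: contraNneq ii0 => E; apply/eqP/val_inj.
have a01 : a i0 < a i1 by exact: incr.
exists ((a i0 + a i1) / 2); rewrite (negPf ev) expr0 (bigD1 i0) //= mulN1r.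
under eq_bigr do rewrite -opprB.
have sgn : (-1) ^+ #|predC1 i0| = -1 :> R.
  by rewrite cardC1 card_ord doubleS -signr_odd /= odd_double expr1.
rewrite (prodrN (predC1 i0)) sgn mulN1r mulrN opprK; apply: mulr_gt0.
  by rewrite subr_gt0 ltr_pdivlMr ?ltr0n // mulr_natr mulr2n ltrD2l.
apply: prodr_gt0 => i ii0; rewrite subr_gt0.
apply: (@lt_le_trans _ _ (a i1)).
  by rewrite ltr_pdivrMr ?ltr0n // mulr_natr mulr2n ltrD2r.
have [->//|ii1] := eqVneq i i1.
apply/ltW/incr; rewrite ltn_neqAle lt0n; apply/andP; split.
  by apply: contraNneq ii1 => E; apply/eqP/val_inj.
by apply: contraNneq ii0 => E; apply/eqP/val_inj.
Qed.

Variables (m : R).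
Hypothesis ma : forall i, m - a i != 0.
Let b i := (m - a i)^-1.

(** Homogeneity reduces to u0 = 1; for u0 = 0 only the last coordinate is left, whose square
    has coefficient -1. *)
Lemma quad_form_veronese (Q : 'M[R]_n.+2) :
  (forall z : C, quad_form Q (\row_i z ^+ i) = - \prod_i (z - ofReal (b i))) ->
  Q ord_max ord_max = -1 -> forall t u0 u1 : C,
  quad_form Q (veronese n t u0 u1) = - (t ^+ 2 * \prod_i (u1 - ofReal (b i) * u0)).
Proof.
move=> QE Qm t u0 u1; have [u00|u00] := eqVneq u0 0.
  have vE i : veronese n t u0 u1 0 i = if i == ord_max then t * u1 ^+ n.+1 else 0.
    rewrite mxE u00; case: eqP => [->|/eqP im]; first by rewrite subnn expr0 mulr1.
    rewrite expr0n subn_eq0 leqNgt ltn_neqAle -ltnS ltn_ord andbT.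
    by rewrite (inj_eq val_inj (_ : 'I__) ord_max) im /= mulr0 mul0r.
  rewrite /quad_form (bigD1 ord_max) //= [X in _ + X]big1 ?addr0; last first.
    by move=> i im; rewrite big1 // => j _; rewrite vE (negPf im) mulr0 mul0r.
  rewrite (bigD1 ord_max) //= big1 ?addr0; last first.
    by move=> j jm; rewrite (vE j) (negPf jm) mulr0.
  rewrite !vE eqxx Qm /ofReal rmorphN1 u00.
  under eq_bigr do rewrite mulr0 subr0.
  rewrite prodr_const card_ord -addnn exprD; ring.
have -> : veronese n t u0 u1 = (t * u0 ^+ n.+1) *: \row_i (u1 / u0) ^+ i.
  apply/rowP => i; rewrite !mxE expr_div_n.
  have -> : u0 ^+ n.+1 = u0 ^+ (n.+1 - i) * u0 ^+ i by rewrite -exprD subnK // -ltnS.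
  by field; rewrite expf_neq0.
rewrite quad_formZ QE mulrN; congr (- _).
have -> : (t * u0 ^+ n.+1) ^+ 2 = t ^+ 2 * u0 ^+ n.+1.*2.
  by rewrite exprMn -exprM muln2.
rewrite -mulrA; congr (_ * _).
rewrite -[X in u0 ^+ X]card_ord -prodr_const -big_split /=.
by apply: eq_bigr => i _; rewrite mulrBr mulrCA divff // mulr1 mulrC.
Qed.

(** The projective map z -> 1 / (m - z) carries the roots [a i] to the roots [b i], at the
    cost of the constant by which the sign of the polynomial can be adjusted. *)
Lemma base_poly_moebius (z0 z1 : C) : \prod_i (z1 - ofReal (a i) * z0) =
  ofReal (\prod_i (m - a i)) * \prod_i (z0 - ofReal (b i) * infty_form m z0 z1).
Proof.
rewrite /ofReal rmorph_prod -big_split /=; apply: eq_bigr => i _.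
rewrite mulrBr mulrA -rmorphM /= mulfV // mul1r /infty_form rmorphB /=.
by rewrite /ofReal; ring.
Qed.

End Moebius.

Theorem proposition6p1 (R : realType) (l : nat) (a : 'I_l.*2 -> R)
    (l_ge3 : (3 <= l)%N)
    (a_incr : forall i j : 'I_l.*2, (i < j)%N -> a i < a j) :
  exists (lam lam' : 'I_(l.-1.+1) -> R) (Q : 'M[R]_(l.-1.+2)),
    hyperelliptic_data Q lam lam' /\
    exists (X : holspace R) (p : X -> minitwistor Q) (s : X -> X),
      [/\ minimal_resolution p,
          real_structure s,
          p \o s =1 sigma Q \o p
        & exists phi : ALE_surface a -> X,
            biholomorphic phi /\ phi \o tau a =1 s \o phi].
Proof.
case: l a l_ge3 a_incr => [//|n] a l_ge3 a_incr.
have n2 : (1 < n)%N by rewrite -ltnS.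
have inja : injective a.
  move=> i j E; apply: val_inj; case: (ltngtP i j) => // ij; have := a_incr _ _ ij;
    by rewrite E ltxx.
have [m mpos] := exists_moving_point a_incr.
pose kappa := \prod_i (m - a i).
have ma i : m - a i != 0.
  apply/eqP => mi; move: mpos; rewrite (bigD1 i) //= mi mul0r mulr0 ltxx //.
have [|lam [lam' [lamlt lamlt' polyE]]] := @hyperelliptic_branch R n (fun i => (m - a i)^-1).
  by move=> i j /invr_inj /addrI /oppr_inj /inja.
have szf : size (hyperelliptic_poly lam lam') = n.+1.*2.+1.
  by rewrite polyE -big_enum size_polyN size_prod_XsubC -cardE card_ord.
have lcf : (hyperelliptic_poly lam lam')`_(n.+1.*2) = -1.
  have -> : (n.+1.*2 = (size (hyperelliptic_poly lam lam')).-1)%N by rewrite szf.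
  rewrite -lead_coefE polyE lead_coefN; congr (- _).
  by apply/eqP; rewrite -[_ == _]/(_ \is monic) monic_prod_XsubC.
have [Q [QE Qm]] := quadratic_representation (eq_leq szf).
exists lam, lam', Q; split; first by split.
pose rho := Num.sqrt (- (-1) ^+ n.+1 * kappa)^-1.
have rho_gt0 : 0 < rho by rewrite sqrtr_gt0 invr_gt0.
have rho0 : rho != 0 by rewrite gt_eqF.
have rhoE : (-1) ^+ n.+1 * rho ^+ 2 * kappa = -1.
  rewrite sqr_sqrtr; last by rewrite invr_ge0 ltW.
  have k0 : (-1) ^+ n.+1 * kappa != 0.
    by move: mpos; rewrite mulNr => /gt_eqF; rewrite oppr_eq0 => ->.
  by rewrite mulNr invrN mulrN mulNr mulrAC mulfV.
have quad_formE (z0 z1 t : Cplx R) :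
    quad_form Q (veronese n t (infty_form m z0 z1) z0) =
    (-1) ^+ n.+1 * ofReal rho ^+ 2 * (t ^+ 2 * \prod_i (z1 - ofReal (a i) * z0)).
  rewrite (quad_form_veronese (a := a) (m := m)).
  - rewrite (base_poly_moebius ma).
    have E : (-1) ^+ n.+1 * ofReal rho ^+ 2 * ofReal kappa = -1 :> Cplx R.
      have := congr1 (real_complex R) rhoE.
      by rewrite rmorphN1 !rmorphM /= !rmorphXn /= rmorphN1.
    transitivity ((-1) ^+ n.+1 * ofReal rho ^+ 2 * ofReal kappa *
      (t ^+ 2 * \prod_i (z0 - ofReal (m - a i)^-1 * infty_form m z0 z1))).
      by rewrite E mulN1r.
    by rewrite -/kappa; ring.
  - by move=> z; rewrite QE polyE horner_branch.
  - by rewrite Qm.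
exists (ALE_surface a), (@resol R n a Q m rho), (tau a); split.
- exact: (resol_minimal_resolution rho0 quad_formE inja (ltnW n2)).
- exact: tau_real_structure.
- by move=> x; exact: (resol_tau rho0 quad_formE).
- exists id; split => //; exists id; split => // x _.
    exact: (holomorphic_id x).
  exact: (holomorphic_id x).
Qed.
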